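(* Let $G$ be a finitely generated group with word length $L$, let $\rho>0$ and let $\sigma(n)=n!$ be the factorial growth. Then $$\mathcal{A}_{L,\rho}(G)=\ell^1_{L,\sigma,\rho^-}(G),$$ i.e. the two locally convex topologies on $\mathbb{C}[G]$ that define these completions coincide, and hence the completions coincide.
   Context: The word length $L(g)\in\mathbb{N}_0$, with respect to a finite generating set $S=S^{-1}$ of $G$, is the minimal number of elements of $S$ needed to write $g$ as a product, $L(e)=0$. $\mathbb{C}[G]$ is the group algebra with basis $\{\mathsf{e}_g\}_{g\in G}$ and elements $a=\sum_g a_g\mathsf{e}_g$ (finite sums); $\mathbb{C}[[G]]$ is the space of all formal series $\sum_{g}a_g\mathsf{e}_g$. Definition of $\mathcal{A}_{L,\rho}(G)$ (construction of Beiser and Waldmann): put $\mathsf{c}(g)=(L(g)!)^\rho$. For $a\in\mathbb{C}[G]$ define recursively $h_{0,0,g}(a)=|a_g|\,\mathsf{c}(g)$ and, for $m\in\mathbb{N}_0$, $\ell=0,\dots,2^m-1$ and $k\in G$, $$h_{m+1,2\ell,k}(a)=\sum_{g\in G}h_{m,\ell,g}(a)^2\,\frac{\mathsf{c}(k)}{\mathsf{c}(g)\,\mathsf{c}(g^{-1}k)},\qquad h_{m+1,2\ell+1,k}(a)=h_{m+1,2\ell,k^{-1}}(a).$$ All these quantities are finite and $\|a\|_{m,\ell,g}=\sqrt[2^m]{h_{m,\ell,g}(a)}$ are seminorms on $\mathbb{C}[G]$. The countable collection of all these seminorms ($m\in\mathbb{N}_0$, $0\le\ell\le2^m-1$, $g\in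 G$) makes $\mathbb{C}[G]$ a locally convex algebra, whose Fréchet algebra completion is $\mathcal{A}_{L,\rho}(G)$. Definition of $\ell^1_{L,\sigma,\rho^-}(G)$: for $R\ge0$ put $\|a\|_{L,\sigma,R}=\sum_{g\in G}|a_g|\,\sigma(L(g))^R$ and $\ell^1_{L,\sigma,R}(G)=\{a\in\mathbb{C}[[G]]:\|a\|_{L,\sigma,R}<\infty\}$. Then $\ell^1_{L,\sigma,\rho^-}(G)=\bigcap_{0<\epsilon\le\rho}\ell^1_{L,\sigma,\rho-\epsilon}(G)$ with the topology of all norms $\|\cdot\|_{L,\sigma,\rho-\epsilon}$, $0<\epsilon\le\rho$; it is the completion of $\mathbb{C}[G]$ for these norms. *)

(* Defs.v *)
From HB Require Import structures.
From mathcomp Require Import all_boot all_order all_algebra finmap complex.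
From mathcomp Require Import all_classical all_reals all_analysis.
From mathcomp Require Import ring lra.

Set Implicit Arguments.
Unset Strict Implicit.
Unset Printing Implicit Defensive.

Import Order.TTheory GRing.Theory Num.Theory.
Import numFieldNormedType.Exports.
Import ComplexField.Normc.

Local Open Scope classical_set_scope.
Local Open Scope ring_scope.
Local Open Scope complex_scope.

Section WordLength.
Variable G : groupType.
Implicit Types (S : set G) (w : seq G) (g : G).

Definition word_for S w g := (forall x, x \in w -> S x) /\ (\prod_(x <- w) x)%g = g.

(* For symmetric S this is generation of G as a group. *)
Definition finite_symmetric_generating_set S :=
  [/\ finite_set S, forall x, S x -> S (x^-1)%g & forall g, exists w, word_for S w g].

(* The [xget] default 0 is only reached when g is not a product of elements of S. *)
Definition word_length S g : nat :=
  xget 0%N [set n | (exists2 w, word_for S w g & size w = n) /\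
                    (forall w, word_for S w g -> (n <= size w)%N)].

End WordLength.

(* The gauges are extended-valued so that the recursively defined sums below
   need no prior finiteness proof. *)
Definition seminormed (K : numFieldType) (V : lmodType K) (R : realType) (I : choiceType)
  (p : I -> V -> \bar R) : Type := V.

Section SeminormTopology.
Variables (K : numFieldType) (V : lmodType K) (R : realType) (I : choiceType).
Variable p : I -> V -> \bar R.

HB.instance Definition _ := GRing.Lmodule.on (seminormed p).

Definition gauge_ball (x : V) (J : {fset I}) (e : R) : set V :=
  [set y | forall i, i \in J -> (p i (y - x)%R < e%:E)%E].

Definition gauge_open : set_system (seminormed p) :=
  [set U | forall x, U x -> exists (J : {fset I}) (e : R), 0 < e /\ gauge_ball x J e `<=` U].

Lemma gauge_openT : gauge_open setT.
Proof. by move=> x _; exists fset0, 1. Qed.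

Lemma gauge_openI : setI_closed gauge_open.
Proof.
move=> A B oA oB x [/oA[J [e [e0 JA]]] /oB[J' [e' [e'0 JB]]]].
exists (J `|` J')%fset, (Num.min e e'); split; first by rewrite lt_min e0.
move=> y yJ; split; [apply: JA|apply: JB] => i iJ;
  by apply: (@lt_le_trans _ _ (Num.min e e')%:E);
    rewrite ?(lee_fin, ge_min, lexx, orbT)//; apply: yJ; rewrite inE iJ ?orbT.
Qed.

Lemma gauge_open_bigU (T : Type) (f : T -> set (seminormed p)) :
  (forall t, gauge_open (f t)) -> gauge_open (\bigcup_t f t).
Proof.
move=> of_ x [t _ /of_[J [e [e0 Jf]]]]; exists J, e; split=> //.
by move=> y /Jf fy; exists t.
Qed.

HB.instance Definition _ :=
  isOpenTopological.Build (seminormed p) gauge_openT gauge_openI gauge_open_bigU.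

End SeminormTopology.

Section SeminormTvs.
Variables (R : realType) (V : lmodType R[i]) (I : choiceType).
Variable p : I -> V -> \bar R.
Hypothesis p_fin : forall i x, p i x \is a fin_num.
Hypothesis p_tri : forall i x y, (p i (x + y)%R <= p i x + p i y)%E.
Hypothesis p_hom : forall i (k : R[i]) x, (p i (k *: x)%R <= (normc k)%:E * p i x)%E.

Local Notation T := (seminormed p).

Let q i x : R := fine (p i x).
Let pq i x : p i x = (q i x)%:E. Proof. by rewrite fineK. Qed.
Let q_tri i x y : q i (x + y) <= q i x + q i y.
Proof. by rewrite -lee_fin EFinD -!pq. Qed.
Let q_hom i k x : q i (k *: x) <= normc k * q i x.
Proof. by rewrite -lee_fin EFinM -!pq. Qed.
Let q0 i : q i 0 <= 0.
Proof. by have := q_hom i 0 0; rewrite scaler0 normc0 mul0r. Qed.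
Let qN i x : q i (- x) <= q i x.
Proof. by have := q_hom i (-1) x; rewrite scaleN1r normcN normc1 mul1r. Qed.
Let q_ge0 i x : 0 <= q i x.
Proof.
have h : q i x <= q i x + q i 0 by rewrite -[in leLHS](addr0 x) q_tri.
have h0 : 0 <= q i 0 by rewrite -(lerD2l (q i x)) addr0.
by have := q_tri i x (- x); rewrite subrr; have := qN i x; lra.
Qed.

Lemma gauge_ball_open x J e : open (gauge_ball p x J e : set T).
Proof.
move=> y yJ.
suff [d d0 dJ] : exists2 d, 0 < d & forall i, i \in J -> d <= e - q i (y - x).
  exists J, d; split=> // z zJ i iJ; have := zJ i iJ; have := dJ i iJ.
  rewrite !pq !lte_fin; have := q_tri i (z - y) (y - x).
  by rewrite addrA subrK; lra.
exists (\big[Num.min/1]_(i <- J) (e - q i (y - x))).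
  rewrite big_seq; elim/big_ind: _ => //; first by move=> a b a0 b0; rewrite lt_min a0.
  by move=> i iJ; have := yJ i iJ; rewrite pq lte_fin subr_gt0.
by move=> i iJ; exact: ge_bigmin_seq.
Qed.

Lemma nbhs_seminormed (x : T) (U : set T) :
  nbhs x U <-> exists (J : {fset I}) (e : R), 0 < e /\ gauge_ball p x J e `<=` U.
Proof.
split=> [[B [oB Bx BU]]|[J [e [e0 JU]]]].
  have [J [e [e0 JB]]] := oB _ Bx; exists J, e; split=> //.
  exact: subset_trans BU.
exists (gauge_ball p x J e); split=> //; first exact: gauge_ball_open.
by move=> i iJ; rewrite subrr pq lte_fin (le_lt_trans (q0 i)).
Qed.

Lemma cvg_seminormed (X : Type) (F : set_system X) (f : X -> T) (x : T) : Filter F ->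
  (forall i e, 0 < e -> \forall y \near F, q i (f y - x) < e) -> f @ F --> x.
Proof.
move=> FF h U /nbhs_seminormed[J [e [e0 JU]]].
have := @filter_bigI _ I J (fun i => [set y | q i (f y - x) < e]) F FF
  (fun i _ => h i e e0).
rewrite -[_ U]/(F (f @^-1` U)); apply: filterS => y yJ; apply: JU => i iJ.
by rewrite pq lte_fin; exact: yJ.
Qed.

Lemma near_seminormed (x : T) i e : 0 < e -> \forall y \near x, q i (y - x) < e.
Proof.
move=> e0; apply/nbhs_seminormed; exists [fset i]%fset, e; split=> // y yi.
by have := yi i (fset11 i); rewrite pq lte_fin.
Qed.

Lemma seminormed_add_continuous : continuous (fun z : T * T => z.1 + z.2).
Proof.
move=> [x y]; apply: cvg_seminormed => i e e0.
have e20 : 0 < e / 2 by rewrite divr_gt0.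
near=> z.
have h1 : q i (z.1 - x) < e / 2.
  by near: z; exact: (cvg_fst (near_seminormed x i e20)).
have h2 : q i (z.2 - y) < e / 2.
  by near: z; exact: (cvg_snd (near_seminormed y i e20)).
rewrite /= opprD addrACA.
by have := q_tri i (z.1 - x) (z.2 - y); lra.
Unshelve. all: by end_near. Qed.

Lemma near_normc (k : R[i]^o) (e : R) : 0 < e -> \forall l \near k, normc (l - k) < e.
Proof.
move=> e0; apply/nbhs_ballP; exists e%:C => /=; first by rewrite ltcR.
move=> l; rewrite -ball_normE /= distrC normc_def ltcR.
by case: (l - k).
Qed.

Lemma seminormed_scale_continuous :
  continuous (fun z : (R[i])^o * T => z.1 *: z.2).
Proof.
move=> [k x]; apply: cvg_seminormed => i e e0.
pose M := normc k + 1 + q i x.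
have nk0 : 0 <= normc k by rewrite /normc; case: (k) => ? ?; exact: sqrtr_ge0.
have M0 : 0 < M by rewrite /M; have := q_ge0 i x; lra.
pose d := Num.min 1 (e / (2 * M)).
have d0 : 0 < d by rewrite lt_min ltr01 divr_gt0// mulr_gt0.
have dM : d * M <= e / 2.
  rewrite -ler_pdivlMr// (_ : e / 2 / M = e / (2 * M)) ?ge_min ?lexx ?orbT//.
  by rewrite invfM mulrA.
have d1 : d <= 1 by rewrite ge_min lexx.
near=> z.
have h1 : normc (z.1 - k) < d.
  by near: z; exact: (cvg_fst (near_normc k d0)).
have h2 : q i (z.2 - x) < d.
  by near: z; exact: (cvg_snd (near_seminormed x i d0)).
have -> : z.1 *: z.2 - k *: x =
    ((z.1 - k) *: (z.2 - x) + k *: (z.2 - x)) + (z.1 - k) *: x.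
  by rewrite -scalerDl subrK scalerBr scalerBl addrA subrK.
have t1 := q_tri i ((z.1 - k) *: (z.2 - x) + k *: (z.2 - x)) ((z.1 - k) *: x).
have t2 := q_tri i ((z.1 - k) *: (z.2 - x)) (k *: (z.2 - x)).
have s1 := q_hom i (z.1 - k) (z.2 - x).
have s2 := q_hom i k (z.2 - x).
have s3 := q_hom i (z.1 - k) x.
have n0 : 0 <= normc (z.1 - k) by rewrite /normc; case: (z.1 - k) => ? ?; exact: sqrtr_ge0.
have := q_ge0 i x; have := q_ge0 i (z.2 - x); move: dM; rewrite /M => *.
by nra.
Unshelve. all: by end_near. Qed.

Lemma seminormed_locally_convex :
  exists2 B : set_system T, (forall b, b \in B -> convex_set b) & basis B.
Proof.
exists [set b | exists x J e, b = gauge_ball p x J e].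
  move=> b; rewrite inE => -[x [J [e ->]]]; apply/convex_setW => y z.
  rewrite !inE => yJ zJ k k0 k1; rewrite inE => i iJ.
  pose y' : V := y; pose z' : V := z.
  have kE : k%:num + (1 - k%:num) = 1 :> R[i] by rewrite addrC subrK.
  have -> : conv k y z - x = k%:num *: (y' - x) + (1 - k%:num) *: (z' - x) :> V.
    rewrite !scalerBr addrACA -opprD -scalerDl kE scale1r.
    by congr (_ - x).
  have := yJ i iJ; have := zJ i iJ; rewrite !pq !lte_fin -/y' -/z'.
  have := q_tri i (k%:num *: (y' - x)) ((1 - k%:num) *: (z' - x)).
  have := q_hom i k%:num (y' - x); have := q_hom i (1 - k%:num) (z' - x).
  have [r [r0 r1 -> ->]] : exists r : R, [/\ 0 < r, r < 1,
      normc k%:num = r & normc (1 - k%:num) = 1 - r].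
    move: k0 k1; case: (k%:num) => u v; rewrite !ltcE /= => /andP[/eqP v0 u0] /andP[_ u1].
    exists u; split=> //; rewrite v0 ?subr0 expr0n addr0 sqrtr_sqr gtr0_norm//.
    by rewrite subr_gt0.
  by nra.
split; first by move=> b [x [J [e ->]]]; exact: gauge_ball_open.
move=> x U /nbhs_seminormed[J [e [e0 JU]]].
exists (gauge_ball p x J e) => //; split; first by exists x, J, e.
by move=> i iJ; rewrite subrr pq lte_fin (le_lt_trans (q0 i)).
Qed.

End SeminormTvs.

Section GroupAlgebra.
Variables (R : realType) (G : groupType).

(* The space C[[G]] of formal series is the full function space [G -> R[i]]. *)
Definition finitely_supported : {pred G -> R[i]} :=
  mem [set a : G -> R[i] | finite_set [set g | a g != 0]].

Lemma finitely_supported_submod : submod_closed finitely_supported.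
Proof.
split=> [|k a b]; rewrite !inE /=.
  by rewrite (_ : [set _ | _] = set0)//; apply/seteqP; split=> // g /=; rewrite eqxx.
move=> fa fb; apply: (@sub_finite_set _ _ ([set g | a g != 0] `|` [set g | b g != 0])).
  move=> g /=; rewrite [_ g](_ : _ = k * a g + b g)//.
  have [->|] := eqVneq (a g) 0; last by left.
  by rewrite mulr0 add0r; right.
by rewrite finite_setU.
Qed.

HB.instance Definition _ :=
  GRing.isSubmodClosed.Build _ _ finitely_supported finitely_supported_submod.

Record group_algebra := GroupAlgebra {
  ga_coef :> G -> R[i];
  ga_coefP : ga_coef \in finitely_supported
}.

HB.instance Definition _ := [isSub for ga_coef].
HB.instance Definition _ := [Choice of group_algebra by <:].
HB.instance Definition _ := [SubChoice_isSubLmodule of group_algebra by <:].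

(* The finite-support sum is 0 by convention on infinite supports; it is only
   used below for finitely supported [a] and [b]. *)
Definition convolution (a b : G -> R[i]) : G -> R[i] :=
  fun k => \sum_(g \in [set: G]) a g * b (g^-1 * k)%g.

Lemma convolution_finitely_supported (a b : group_algebra) :
  convolution a b \in finitely_supported.
Proof.
rewrite inE /=; have := ga_coefP a; have := ga_coefP b; rewrite !inE /= => fb fa.
apply: (@sub_finite_set _ _
  [set (x * y)%g | x in [set g | a g != 0] & y in [set g | b g != 0]]).
  move=> k /=; apply: contraPP => nk; apply/negP; rewrite negbK; apply/eqP.
  rewrite /convolution fsbig1// => g _.
  have [->|ag] := eqVneq (a g) 0; first by rewrite mul0r.
  have [->|bg] := eqVneq (b (g^-1 * k)%g) 0; first by rewrite mulr0.
  case: nk; exists g => //; exists (g^-1 * k)%g => //.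
  by rewrite mulgA mulgV mul1g.
exact: finite_image2.
Qed.

Definition ga_mul (a b : group_algebra) : group_algebra :=
  GroupAlgebra (convolution_finitely_supported a b).

End GroupAlgebra.

Section BeiserWaldmann.
Variables (R : realType) (G : groupType) (L : G -> nat) (rho : R).
Implicit Type a : group_algebra R G.

Definition bw_c (g : G) : R := ((L g)`!%:R) `^ rho.

(* At level m+1 the index l is 2 l' or 2 l' + 1 with l' = l./2; the odd index
   evaluates the even one at the inverse. *)
Fixpoint bw_h a (m l : nat) (k : G) : \bar R :=
  match m with
  | 0%N => (normc (a k) * bw_c k)%:E
  | m'.+1 =>
    let k' := if odd l then (k^-1)%g else k in
    \esum_(g in [set: G])
      ((bw_h a m' l./2 g) ^+ 2 * (bw_c k' / (bw_c g * bw_c (g^-1 * k')%g))%:E)%E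
  end.

(* Indices are the triples (m, l, g) with l < 2 ^ m. *)
Definition bw_index := ({m : nat & 'I_(2 ^ m)} * G)%type.

Definition bw_seminorm (i : bw_index) a : \bar R :=
  (bw_h a (tag i.1) (tagged i.1) i.2 `^ ((2 ^+ tag i.1)^-1))%E.

End BeiserWaldmann.

Section Ell1.
Variables (R : realType) (G : groupType) (L : G -> nat) (sigma : nat -> R).
Implicit Types (a : G -> R[i]) (r rho : R).

Definition ell1_norm r a : \bar R :=
  \esum_(g in [set: G]) (normc (a g) * sigma (L g) `^ r)%:E.

Definition ell1 r : set (G -> R[i]) := [set a | (ell1_norm r a < +oo)%E].

Definition ell1_index rho := {e : R | 0 < e <= rho}.

Definition ell1_minus_pred rho : {pred G -> R[i]} :=
  mem (\bigcap_(e : ell1_index rho) ell1 (rho - val e)).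

Lemma normc_ge0 (z : R[i]) : 0 <= normc z.
Proof. by rewrite /normc; case: z => ? ?; exact: sqrtr_ge0. Qed.

Lemma ell1_norm_ge0 r a : (0 <= ell1_norm r a)%E.
Proof. by apply: esum_ge0 => g _; rewrite lee_fin mulr_ge0 ?normc_ge0 ?powR_ge0. Qed.

Lemma ell1_normD r a b : (ell1_norm r (a + b)%R <= ell1_norm r a + ell1_norm r b)%E.
Proof.
rewrite -esumD; last 2 first.
- by move=> g _; rewrite lee_fin mulr_ge0 ?normc_ge0 ?powR_ge0.
- by move=> g _; rewrite lee_fin mulr_ge0 ?normc_ge0 ?powR_ge0.
apply: le_esum => g _; rewrite -EFinD lee_fin -mulrDl ler_wpM2r ?powR_ge0//.
exact: le_normcD.
Qed.

Lemma ell1_normZ r (k : R[i]) a : (ell1_norm r (k *: a)%R <= (normc k)%:E * ell1_norm r a)%E.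
Proof.
apply: ge_ereal_sup => _ [A [finA AT] <-]; rewrite fsbig_finite//=.
rewrite (eq_bigr (fun g => (normc k)%:E * (normc (a g) * sigma (L g) `^ r)%:E)%E); last first.
  by move=> g _; rewrite -EFinM mulrA; congr (_ * _)%:E; exact: normcM.
rewrite -ge0_sume_distrr; last first.
  by move=> g _; rewrite lee_fin mulr_ge0 ?normc_ge0 ?powR_ge0.
rewrite lee_wpmul2l ?lee_fin ?normc_ge0//.
by apply: ereal_sup_ubound; exists A; rewrite ?fsbig_finite.
Qed.

Lemma ell1_minus_submod rho : submod_closed (ell1_minus_pred rho).
Proof.
split=> [|k a b]; rewrite !inE /=.
  move=> e _; rewrite /ell1 /= [ell1_norm _ _]esum1 ?ltry// => g _.
  by rewrite normc0 mul0r.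
move=> aP bP e _; apply: (le_lt_trans (ell1_normD _ _ _)).
rewrite lte_add_pinfty//; last exact: bP.
apply: (le_lt_trans (ell1_normZ _ _ _)).
by rewrite lte_mul_pinfty ?lee_fin ?normc_ge0//; exact: aP.
Qed.

HB.instance Definition _ rho :=
  GRing.isSubmodClosed.Build _ _ (ell1_minus_pred rho) (ell1_minus_submod rho).

Record ell1_minus_carrier rho := Ell1Minus {
  ell1_coef :> G -> R[i];
  ell1_coefP : ell1_coef \in ell1_minus_pred rho
}.

HB.instance Definition _ rho := [isSub for @ell1_coef rho].
HB.instance Definition _ rho := [Choice of ell1_minus_carrier rho by <:].
HB.instance Definition _ rho := [SubChoice_isSubLmodule of ell1_minus_carrier rho by <:].

Definition ell1_minus_norm rho (e : ell1_index rho) (a : ell1_minus_carrier rho) : \bar R :=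
  ell1_norm (rho - val e) a.

Definition ell1_minus rho : Type :=
  seminormed (@ell1_minus_norm rho).

HB.instance Definition _ rho := Topological.on (ell1_minus rho).
HB.instance Definition _ rho := GRing.Lmodule.on (ell1_minus rho).

Lemma ell1_minus_norm_fin rho (e : ell1_index rho) (a : ell1_minus_carrier rho) :
  ell1_minus_norm e a \is a fin_num.
Proof.
rewrite ge0_fin_numE ?ell1_norm_ge0//.
by have := ell1_coefP a; rewrite inE => /(_ e I).
Qed.

Lemma ell1_minus_normD rho (e : ell1_index rho) (a b : ell1_minus_carrier rho) :
  (ell1_minus_norm e (a + b)%R <= ell1_minus_norm e a + ell1_minus_norm e b)%E.
Proof. exact: ell1_normD. Qed.

Lemma ell1_minus_normZ rho (e : ell1_index rho) (k : R[i]) (a : ell1_minus_carrier rho) :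
  (ell1_minus_norm e (k *: a)%R <= (normc k)%:E * ell1_minus_norm e a)%E.
Proof. exact: ell1_normZ. Qed.

Definition ell1_minus_add_continuous rho := seminormed_add_continuous
  (@ell1_minus_norm_fin rho) (@ell1_minus_normD rho) (@ell1_minus_normZ rho).
Definition ell1_minus_scale_continuous rho := seminormed_scale_continuous
  (@ell1_minus_norm_fin rho) (@ell1_minus_normD rho) (@ell1_minus_normZ rho).
Definition ell1_minus_locally_convex rho := seminormed_locally_convex
  (@ell1_minus_norm_fin rho) (@ell1_minus_normD rho) (@ell1_minus_normZ rho).

(* [PreTopologicalLmod_isTvs] only builds the uniform structure. *)
HB.instance Definition _ rho :=
  PreTopologicalLmod_isTvs.Build R[i] (ell1_minus rho)
    (@ell1_minus_add_continuous rho) (@ell1_minus_scale_continuous rho)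
    (@ell1_minus_locally_convex rho).
HB.instance Definition _ rho := PreTopologicalNmodule_isTopologicalNmodule.Build
  (ell1_minus rho) (@ell1_minus_add_continuous rho).
HB.instance Definition _ rho := TopologicalNmodule_isTopologicalLmodule.Build
  R[i] (ell1_minus rho) (@ell1_minus_scale_continuous rho).
HB.instance Definition _ rho := Uniform_isTvs.Build
  R[i] (ell1_minus rho) (@ell1_minus_locally_convex rho).

Lemma ga_in_ell1_minus rho (a : group_algebra R G) :
  (a : G -> R[i]) \in ell1_minus_pred rho.
Proof.
rewrite inE => e _; have := ga_coefP a; rewrite inE /= => fa.
rewrite /ell1 /= /ell1_norm.
rewrite [X in (X < _)%E](_ : _ = \esum_(g in [set g | (a g != 0)%R])
    (normc (a g) * sigma (L g) `^ (rho - val e))%:E)%E; last first.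
  rewrite [RHS]esum_mkcond; apply: eq_esum => g _.
  case: ifPn => //; rewrite notin_setE /= => /negP; rewrite negbK => /eqP ->.
  by rewrite normc0 mul0r.
rewrite esum_fset//; last first.
  by move=> g _; rewrite lee_fin mulr_ge0 ?normc_ge0 ?powR_ge0.
by rewrite fsbig_finite//= sumEFin ltry.
Qed.

Definition ga_ell1_norm rho (e : ell1_index rho) (a : group_algebra R G) : \bar R :=
  ell1_norm (rho - val e) a.

Definition ga_ell1_minus rho (a : group_algebra R G) : ell1_minus rho :=
  Ell1Minus (ga_in_ell1_minus rho a).

End Ell1.

(* The uniform structure of a [tvsType] is only required to be compatible with
   its topology, hence Cauchy filters are phrased here with differences. *)
Definition tvs_complete (K : numFieldType) (A : tvsType K) :=
  forall F : set_system A, ProperFilter F ->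
    (forall U : set A, nbhs (0 : A) U ->
      exists2 B, F B & forall x y, B x -> B y -> U (x - y)) ->
    exists x : A, F --> x.

Record topological_algebra_law (K : numFieldType) (A : tvsType K) (mul : A -> A -> A) : Prop := {
  tal_assoc : associative mul;
  tal_linearl : forall y, linear (mul^~ y);
  tal_linearr : forall x, linear (mul x);
  tal_continuous : continuous (fun z : A * A => mul z.1 z.2)
}.

(* [A] is a complete Hausdorff locally convex algebra and [iota] is a dense
   topological embedding of [V]; [mulA] is then the unique continuous extension
   of [mulV]. If the topology of [V] is given by countably many seminorms, [A] is
   a Frechet algebra. *)
Record algebra_completion (K : numFieldType)
    (V : preTopologicalLmodType K) (mulV : V -> V -> V)
    (A : tvsType K) (mulA : A -> A -> A) (iota : V -> A) : Prop := {
  ac_law : topological_algebra_law mulA;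
  ac_hausdorff : hausdorff_space A;
  ac_complete : tvs_complete A;
  ac_linear : linear iota;
  ac_mul : {morph iota : a b / mulV a b >-> mulA a b};
  ac_embedding : forall U : set V,
    open U <-> exists2 O : set A, open O & U = iota @^-1` O;
  ac_dense : dense (range iota)
}.

Record topological_algebra_iso (K : numFieldType) (A B : tvsType K)
    (mulA : A -> A -> A) (mulB : B -> B -> B) (Phi : A -> B) : Prop := {
  tai_linear : linear Phi;
  tai_mul : {morph Phi : x y / mulA x y >-> mulB x y};
  tai_continuous : continuous Phi;
  tai_inverse : exists Psi : B -> A, [/\ cancel Phi Psi, cancel Psi Phi & continuous Psi]
}.

(* Main.v *)
(** Write [c(g) = (L(g)!)^rho] and [F(g) = L(g)!].
    The Beiser-Waldmann seminorms are continuous for the weighted l1 norms: since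
    [c(k) <= 2^(rho (L(g) + L(g^-1 k))) c(g) c(g^-1 k)], the quotient in the
    recursion is at most [F(k)^e F(g)^-e] up to an exponential in [L(g)]. If level
    [m] is bounded by [F(g)^(e/4)], its square [F(g)^(e/2)] is beaten by
    [F(g)^-e], and what remains is summable because the spheres of [G] grow at
    most exponentially; so level [m+1] is bounded by [F(k)^e].
    Conversely, the diagonal terms of the recursion give
    [(|a_g| c(g))^(2^m) <= h_(m,0,g)], and one more step evaluated at the unit, where
    the weight is [1 / c(g)^2], gives [|a_g| c(g)^(1 - 2^-m) <= ||a||_(m+1,0,1)];
    summing over [g] costs an arbitrarily small power of [F].
    The product of [l1] is the extension by density of the convolution of finitely
    supported functions, and two completions of the same algebra are isomorphic
    by extending the two embeddings along each other. *)

Require Import Defs.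
From HB Require Import structures.
From mathcomp Require Import all_boot all_order all_algebra finmap complex.
From mathcomp Require Import all_classical all_reals all_analysis.
From mathcomp Require Import ring lra.

Set Implicit Arguments.
Unset Strict Implicit.
Unset Printing Implicit Defensive.

Import Order.TTheory GRing.Theory Num.Theory.
Import numFieldNormedType.Exports.
Import ComplexField.Normc.

Local Open Scope classical_set_scope.
Local Open Scope ring_scope.
Local Open Scope complex_scope.

(** * Density, continuity and extension of maps from dense subsets *)

Lemma dense_continuous_eq (T B : topologicalType) (V : Type) (j : V -> T) (F G : T -> B) :
  hausdorff_space B -> dense (range j) -> continuous F -> continuous G ->
  (forall v, F (j v) = G (j v)) -> F =1 G.
Proof.
move=> hB dj cF cG FG x; apply: hB => A C FA GC.
have : nbhs x (F @^-1` A `&` G @^-1` C) by apply: filterI; [exact: cF|exact: cG].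
rewrite nbhsE => -[D [oD Dx] DAC].
have [z [Dy [v _ jv]]] := dj _ (ex_intro _ x Dx) oD.
by rewrite -{}jv in Dy; have [? ?] := DAC _ Dy; exists (F (j v)); split => //; rewrite FG.
Qed.

Lemma dense_range_pair (T T' : topologicalType) (V V' : Type) (j : V -> T) (j' : V' -> T') :
  dense (range j) -> dense (range j') ->
  dense (range (fun v : V * V' => (j v.1, j' v.2))).
Proof.
move=> dj dj' D [[x y] Oxy] oD.
have : nbhs (x, y) D by exact: open_nbhs_nbhs.
move=> [[A B] /= [+ +] ABO]; rewrite !nbhsE => -[P [oP Px] PA] [Q [oQ Qy] QB].
have [p [Px' [v _ jv]]] := dj _ (ex_intro _ x Px) oP; rewrite -{}jv in Px'.
have [q [Qy' [w _ jw]]] := dj' _ (ex_intro _ y Qy) oQ; rewrite -{}jw in Qy'.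
exists (j v, j' w); split; last by exists (v, w).
by apply: ABO; split; [exact: PA|exact: QB].
Qed.

Lemma continuous_comp_fun (X Y Z : topologicalType) (f : X -> Y) (g : Y -> Z) :
  continuous f -> continuous g -> continuous (fun x => g (f x)).
Proof. by move=> cf cg x; exact: continuous_comp (cf x) (cg (f x)). Qed.

Lemma continuous_fst (X Y : topologicalType) : continuous (@fst X Y).
Proof. by move=> z; exact: cvg_fst. Qed.

Lemma continuous_snd (X Y : topologicalType) : continuous (@snd X Y).
Proof. by move=> z; exact: cvg_snd. Qed.

Lemma continuous_pair_comp (X T T' B : topologicalType) (h : T * T' -> B)
    (f : X -> T) (g : X -> T') :
  continuous h -> continuous f -> continuous g -> continuous (fun x => h (f x, g x)).
Proof.
move=> ch cf cg x; apply: (cvg_comp (fun x => (f x, g x)) h _ (ch (f x, g x))).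
exact: cvg_pair (cf x) (cg x).
Qed.

Lemma continuous_scaler (K : numFieldType) (A : tvsType K) (k : K) :
  continuous (fun x : A => k *: x).
Proof.
move=> x; apply: (@continuous_comp _ (K^o * A)%type _
  (fun x => (k : K^o, x)) (fun z => z.1 *: z.2)).
  by apply: (@cvg_pair _ _ _ _ (nbhs (k : K^o))); [exact: cvg_cst|exact: cvg_id].
exact: scale_continuous.
Qed.

(** The hypothesis says that [f] sends the trace on [V] of the neighbourhoods of each point to a
    Cauchy filter. It is local in [x], hence weaker than uniform continuity, and so it also covers a
    product of two variables. *)
Lemma dense_extension (K : numFieldType) (T : topologicalType) (V : Type)
    (B : tvsType K) (j : V -> T) (f : V -> B) :
  dense (range j) -> tvs_complete B ->
  (forall (x : T) U, nbhs (0 : B) U -> exists2 W : set T, nbhs x W &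
     forall v w, W (j v) -> W (j w) -> U (f v - f w)) ->
  hausdorff_space B ->
  exists2 F : T -> B, continuous F & forall v, F (j v) = f v.
Proof.
move=> dj cB fC hB.
(* [E x] is the image under [f] of the trace on [V] of the neighbourhoods of [x]. *)
pose E (x : T) : set_system B :=
  [set A | exists2 W : set T, nbhs x W & forall v, W (j v) -> A (f v)].
have PE x : ProperFilter (E x).
  split.
    move=> [W]; rewrite nbhsE => -[D [oD Dx] DW] W0.
    have [z [Dy [v _ jv]]] := dj _ (ex_intro _ x Dx) oD; rewrite -{}jv in Dy.
    by apply: (W0 v); exact: DW.
  split; first by exists setT => //; exact: filterT.
    move=> P Q [W Wx WP] [W' Wx' WQ]; exists (W `&` W'); first exact: filterI.
    by move=> v [/WP ? /WQ ?].
  by move=> P Q PQ [W Wx WP]; exists W => // v /WP /PQ.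
have Ecvg x : exists y : B, E x --> y.
  apply: (cB _ (PE x)) => U U0; have [W Wx WU] := fC x U U0.
  exists (f @` [set v | W (j v)]); first by exists W => // v Wv; exists v.
  by move=> _ _ [v Wv <-] [w Ww <-]; exact: WU.
pose F x := xget (0 : B) [set y : B | E x --> y].
have EF x : E x --> F x.
  by rewrite /F; have [y Ey] := Ecvg x; case: xgetP => [z -> //|/(_ y)].
exists F.
  (* Values of [F] near [x] lie in the closure of values of [f], hence in a closed
     neighbourhood of [F x] inside [A], which exists because [B] is regular. *)
  move=> x A /uniform_regular[C FC CA].
  have [W] : exists2 W : set T, nbhs x W & forall v, W (j v) -> C (f v) := EF x C FC.
  rewrite {1}nbhsE => -[D [oD Dx] DW] WC.
  have DA : D `<=` F @^-1` A.
    move=> y Dy; apply: CA => C1 FD.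
    have EyC : E y C by exists D; [exact: open_nbhs_nbhs|move=> v /DW /WC].
    by have /filter_ex := @filterI _ _ (PE y) _ _ EyC (EF y _ FD).
  have Dx' : nbhs x D by exact: open_nbhs_nbhs.
  exact: filterS DA Dx'.
move=> v; apply: hB => A C FA fC'.
have [W Wv WA] : exists2 W : set T, nbhs (j v) W & forall w, W (j w) -> A (f w) :=
  EF _ _ FA.
by exists (f v); split; [exact: WA (nbhs_singleton Wv)|exact: nbhs_singleton fC'].
Qed.

(** * Uniqueness of the completion of a topological algebra *)

Section Completion.
Variables (K : numFieldType) (V : preTopologicalLmodType K) (mulV : V -> V -> V).
Variables (A B : tvsType K) (mulA : A -> A -> A) (mulB : B -> B -> B).
Variables (iA : V -> A) (iB : V -> B).
Hypothesis cA : algebra_completion mulV mulA iA.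
Hypothesis cB : algebra_completion mulV mulB iB.

(** Both embeddings induce the topology of [V]: an open neighbourhood of zero in [B] is traced back
    to [V] and from there to an open set of [A]. Continuity of subtraction at [(x, x)] then makes
    [iB] Cauchy along [iA], and linearity of the extension passes from dense pairs to all pairs. *)
Lemma completion_map : exists Phi : A -> B,
  [/\ continuous Phi, linear Phi & forall v, Phi (iA v) = iB v].
Proof.
have linA := ac_linear cA; have linB := ac_linear cB.
have subA v w : iA (v - w) = iA v - iA w.
  by rewrite -scaleN1r addrC linA scaleN1r addrC.
have subB v w : iB (v - w) = iB v - iB w.
  by rewrite -scaleN1r addrC linB scaleN1r addrC.
have fC (x : A) (U : set B) : nbhs (0 : B) U -> exists2 W : set A, nbhs x W &
    forall v w, W (iA v) -> W (iA w) -> U (iB v - iB w).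
  rewrite {1}nbhsE => -[P [oP P0] PU].
  have : open (iB @^-1` P) by apply/(ac_embedding cB); exists P.
  move=> /(ac_embedding cA)[D oD PD].
  have O0 : nbhs ((x - x) : A) D.
    rewrite subrr; apply: open_nbhs_nbhs; split => //.
    have : (iB @^-1` P) 0 by rewrite /= -(subrr 0) subB subrr.
    by rewrite PD /= -[X in iA X](subrr 0) subA subrr.
  have [[W1 W2] /= [W1x W2x] W12] := @sub_continuous A (x, x) D O0.
  exists (W1 `&` W2); first exact: filterI.
  move=> v w [Wv _] [_ Ww]; apply: PU; rewrite -subB.
  suff : (iB @^-1` P) (v - w) by [].
  by rewrite PD /= subA; apply: (W12 (iA v, iA w)).
have [Phi cPhi PhiE] := dense_extension (ac_dense cA) (ac_complete cB) fC (ac_hausdorff cB).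
exists Phi; split => // k x y.
have dd := dense_range_pair (ac_dense cA) (ac_dense cA).
pose F (z : A * A) := Phi (k *: z.1 + z.2).
pose G (z : A * A) := k *: Phi z.1 + Phi z.2.
have cadd (C : tvsType K) : continuous (fun z : C * C => z.1 + z.2) by exact: add_continuous.
have csc (C : tvsType K) : continuous (fun z : C => k *: z) by exact: continuous_scaler.
have c1 := @continuous_fst A A; have c2 := @continuous_snd A A.
have cF : continuous F.
  exact: (continuous_comp_fun
    (continuous_pair_comp (cadd A) (continuous_comp_fun c1 (csc A)) c2) cPhi).
have cG : continuous G.
  exact: (continuous_pair_comp (cadd B)
    (continuous_comp_fun (continuous_comp_fun c1 cPhi) (csc B)) (continuous_comp_fun c2 cPhi)).
apply: (dense_continuous_eq (ac_hausdorff cB) dd cF cG _ (x, y)) => -[v w].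
by rewrite /F /G /= -linA !PhiE linB.
Qed.

Lemma completion_map_mul (Phi : A -> B) : continuous Phi ->
  (forall v, Phi (iA v) = iB v) -> {morph Phi : x y / mulA x y >-> mulB x y}.
Proof.
move=> cPhi PhiE x y.
have dd := dense_range_pair (ac_dense cA) (ac_dense cA).
have cmA := tal_continuous (ac_law cA); have cmB := tal_continuous (ac_law cB).
have c1 := @continuous_fst A A; have c2 := @continuous_snd A A.
have cF : continuous (fun z : A * A => Phi (mulA z.1 z.2)).
  exact: (continuous_comp_fun cmA cPhi).
have cG : continuous (fun z : A * A => mulB (Phi z.1) (Phi z.2)).
  exact: (continuous_pair_comp cmB (continuous_comp_fun c1 cPhi) (continuous_comp_fun c2 cPhi)).
apply: (dense_continuous_eq (ac_hausdorff cB) dd cF cG _ (x, y)) => -[v w] /=.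
by rewrite -(ac_mul cA) !PhiE (ac_mul cB).
Qed.

End Completion.

Lemma completion_unique (K : numFieldType) (V : preTopologicalLmodType K)
    (mulV : V -> V -> V) (A B : tvsType K) (mulA : A -> A -> A) (mulB : B -> B -> B)
    (iA : V -> A) (iB : V -> B) :
  algebra_completion mulV mulA iA -> algebra_completion mulV mulB iB ->
  exists Phi : A -> B,
    topological_algebra_iso mulA mulB Phi /\ forall v, Phi (iA v) = iB v.
Proof.
move=> cA cB.
have [Phi [cPhi lPhi PhiE]] := completion_map cA cB.
have [Psi [cPsi lPsi PsiE]] := completion_map cB cA.
exists Phi; split => //; split => //; first exact: (completion_map_mul cA cB).
exists Psi; split => //.
- apply: (dense_continuous_eq (ac_hausdorff cA) (ac_dense cA)).
  + exact: (continuous_comp_fun cPhi cPsi).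
  + by move=> x; exact: cvg_id.
  + by move=> v; rewrite PhiE PsiE.
- apply: (dense_continuous_eq (ac_hausdorff cB) (ac_dense cB)).
  + exact: (continuous_comp_fun cPsi cPhi).
  + by move=> x; exact: cvg_id.
  + by move=> v; rewrite PsiE PhiE.
Qed.

(** * Unordered sums and estimates for factorials *)

Lemma esum_leP (R : realType) (T : choiceType) (f : T -> R) (M : R) :
  (\esum_(g in [set: T]) (f g)%:E <= M%:E)%E <->
  (forall B : {fset T}, \sum_(g <- B) f g <= M).
Proof.
split=> [h B|h].
  rewrite -lee_fin -sumEFin; apply: le_trans h; apply: esum_ge.
  by exists [set` B] => //; rewrite fsbig_finite//= set_fsetK.
apply: ge_ereal_sup => _ [X [finX _] <-].
by rewrite fsbig_finite//= sumEFin lee_fin.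
Qed.

Lemma le_esum_term (R : realType) (T : choiceType) (f : T -> \bar R) (g : T) :
  (f g <= \esum_(h in [set: T]) f h)%E.
Proof. by apply: esum_ge; exists [set g]; rewrite ?fsbig_set1. Qed.

Lemma leq_bin_exp2 n k : ('C(n, k) <= 2 ^ n)%N.
Proof.
elim: n k => [|n IH] [|k] //; first by rewrite bin0 expn_gt0.
by rewrite binS expnS mul2n -addnn leq_add.
Qed.

(** The quotient of [(m + n)!] by [m! n!] is a binomial coefficient. *)
Lemma leq_factD m n : ((m + n)`! <= 2 ^ (m + n) * (m`! * n`!))%N.
Proof.
have := bin_fact (leq_addr n m); rewrite addKn => <-.
by rewrite leq_mul2r leq_bin_exp2 orbT.
Qed.

Section Factorials.
Variable R : realType.

Lemma powR_exprn (x r : R) n : 0 <= x -> (x ^+ n) `^ r = (x `^ r) ^+ n.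
Proof.
move=> x0; elim: n => [|n IH]; first by rewrite !expr0 powR1.
by rewrite !exprS powRM ?exprn_ge0// IH.
Qed.

(** With [y^e = x], the exponential series gives [y^n <= exp(y) n!]; raise this to the power [e]. *)
Lemma expr_le_fact_powR (x e : R) : 0 < x -> 0 < e ->
  exists2 C, 0 < C & forall n, x ^+ n <= C * (n`!%:R : R) `^ e.
Proof.
move=> x0 e0; have [y y0 ye] : exists2 y, 0 < y & y `^ e = x.
  by exists (x `^ e^-1); rewrite ?powR_gt0// -powRrM mulVf ?gt_eqF// powRr1// ltW.
exists (expR y `^ e) => [|n]; first by rewrite powR_gt0// expR_gt0.
have n0 : 0 < n`!%:R :> R by rewrite ltr0n fact_gt0.
have hn : y ^+ n <= expR y * n`!%:R.
  rewrite -ler_pdivrMr//; case: n {n0} => [|n].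
    by rewrite expr0 fact0 divr1 (le_trans _ (expR_ge1Dx y))// lerDl ltW.
  by apply: (le_trans _ (expR_ge1Dxn n (ltW y0))); rewrite lerDr ler01.
have -> : x ^+ n = (y ^+ n) `^ e.
  by rewrite powR_exprn ?ye// ltW.
rewrite -powRM ?expR_ge0 ?(ltW n0)//.
by apply: ge0_ler_powR; rewrite ?nnegrE ?(ltW e0) ?exprn_ge0 ?mulr_ge0 ?expR_ge0 ?(ltW y0)// ltW.
Qed.

Lemma sum_half_le2 N : \sum_(0 <= n < N) (2^-1 : R) ^+ n <= 2.
Proof.
suff -> : \sum_(0 <= n < N) (2^-1 : R) ^+ n = 2 - 2 * 2^-1 ^+ N.
  by rewrite gerBl mulr_ge0// exprn_ge0// invr_ge0.
elim: N => [|N IH]; first by rewrite big_nil expr0; lra.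
by rewrite big_nat_recr//= IH exprS; lra.
Qed.

End Factorials.

(** * Word length and exponential growth of the group *)

Section WordLengthTheory.
Variables (G : groupType) (S : set G).
Hypothesis hS : finite_symmetric_generating_set S.
Local Notation L := (word_length S).

(** Since [S] generates, some word represents [g]; the set under [xget] is inhabited and its default
    value is never taken. *)
Lemma word_length_spec g :
  (exists2 w, word_for S w g & size w = L g) /\
  (forall w, word_for S w g -> (L g <= size w)%N).
Proof.
have [_ _ gen] := hS; have [w0 hw0] := gen g.
pose P n := `[< exists2 w, word_for S w g & size w = n >].
have exP : exists n, P n by exists (size w0); apply/asboolP; exists w0.
have spec : [set n | (exists2 w, word_for S w g & size w = n) /\
                    (forall w, word_for S w g -> (n <= size w)%N)] (ex_minn exP).
  case: ex_minnP => n /asboolP Pn nmin; split => // w hw.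
  by apply: nmin; apply/asboolP; exists w.
by rewrite /word_length; case: xgetP => [n -> //|/(_ (ex_minn exP))].
Qed.

Lemma word_length_le g w : word_for S w g -> (L g <= size w)%N.
Proof. by have [_] := word_length_spec g; exact. Qed.

Lemma word_length1 : L 1%g = 0%N.
Proof.
apply/eqP; rewrite -leqn0; apply: (@word_length_le _ [::]); split => //.
by rewrite big_nil.
Qed.

Lemma word_lengthM g h : (L (g * h)%g <= L g + L h)%N.
Proof.
have [[w [wS wg] <-] _] := word_length_spec g.
have [[v [vS vh] <-] _] := word_length_spec h.
rewrite -size_cat; apply: word_length_le; split; last by rewrite big_cat wg vh.
by move=> x; rewrite mem_cat => /orP[/wS|/vS].
Qed.

Lemma word_lengthV g : L (g^-1)%g = L g.
Proof.
have [_ symS _] := hS.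
have le h : (L (h^-1)%g <= L h)%N.
  have [[w [wS wh] <-] _] := word_length_spec h.
  rewrite -(size_map (fun x => x^-1)%g) -size_rev; apply: word_length_le; split.
    by move=> x; rewrite mem_rev => /mapP[y /wS Sy ->]; exact: symS.
  by rewrite -map_rev big_map -wh prodgV revK.
by apply/eqP; rewrite eqn_leq le -[in leqLHS](invgK g) le.
Qed.

Lemma word_length_summable (R : realType) :
  exists2 D : R, 0 < D & (\esum_(g in [set: G]) (D ^- L g)%:E <= 2%:E)%E.
Proof.
have [/finite_seqP[s Ss] _ _] := hS.
(* [W n] lists, with repetitions, all products of [n] letters, so the sphere of radius [n] has at
   most [size s ^ n] elements. *)
pose W n := iter n (fun ws => [seq (x * g)%g | x <- s, g <- ws]) [:: 1%g].
have sW n : size (W n) = (size s ^ n)%N.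
  by elim: n => // n IH; rewrite /= size_allpairs -/(W n) IH expnS.
have WL g : g \in W (L g).
  have [[w [wS wg] <-] _] := word_length_spec g.
  elim: w g wS wg => [|x w IH] g wS /=; first by rewrite big_nil => <-; rewrite inE.
  rewrite big_cons => <-; apply/allpairsP; exists (x, (\prod_(y <- w) y)%g).
  split => //=.
    by have := wS x (mem_head _ _); rewrite Ss.
  by apply: IH => // y yw; apply: wS; rewrite inE yw orbT.
(* The successor keeps [D] positive when [S] is empty; the factor 2 leaves a geometric series of
   ratio 1/2 after the sum is grouped by length. *)
pose D : R := 2 * (size s).+1%:R.
have D0 : 0 < D by rewrite mulr_gt0.
exists D => //; apply/esum_leP => B.
pose N := (\max_(g <- B) L g).+1.
have -> : \sum_(g <- B) D ^- L g = \sum_(0 <= n < N) \sum_(g <- B | L g == n) D ^- n.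
  rewrite (exchange_big_dep predT)//= big_seq [RHS]big_seq; apply: eq_bigr => g gB.
  have gN : (L g < N)%N by rewrite ltnS; exact: leq_bigmax_seq.
  rewrite big_mkord (bigD1 (Ordinal gN))//= big1 ?addr0// => i /andP[/eqP h /negP[]].
  by apply/eqP/val_inj.
apply: (le_trans _ (sum_half_le2 R N)); apply: ler_sum => n _.
rewrite big_const_seq iter_addr_0.
have cB : (count (fun g => L g == n) B <= size s ^ n)%N.
  rewrite -sW -size_filter; apply: uniq_leq_size; first exact/filter_uniq/fset_uniq.
  by move=> g; rewrite mem_filter => /andP[/eqP <- _]; exact: WL.
have s0 : 0 < (size s).+1%:R :> R by rewrite ltr0n.
have -> : (2^-1 : R) ^+ n = D ^- n * (size s).+1%:R ^+ n.
  by rewrite /D exprMn invfM -mulrA mulVf ?mulr1 ?exprVn// expf_neq0// gt_eqF.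
rewrite -[leLHS]mulr_natr ler_wpM2l ?invr_ge0 ?exprn_ge0 ?(ltW D0)//.
rewrite -natrX ler_nat (leq_trans cB)//; case: (n) => // k.
by rewrite leq_exp2r.
Qed.

End WordLengthTheory.

(** * Comparison of the Beiser-Waldmann seminorms with the weighted norms *)

Lemma powR_quot_le (R : realType) (u v w T r e : R) :
  1 <= T -> 0 < u -> 0 < v -> 0 < w -> w <= T * (u * v) -> 0 <= e <= r ->
  w `^ r / (u `^ r * v `^ r) <= T `^ r * (w `^ e * (u `^ (- e) * v `^ (- e))).
Proof.
move=> T1 u0 v0 w0 wT /andP[e0 er].
have T0 : 0 < T by exact: lt_le_trans T1.
(* Only the part [r - e] of the exponent is estimated by [w <= T * (u * v)]. The part [e] is kept,
   which leaves the decaying factors in [u] and [v]; finally [T^(r - e) <= T^r] because [1 <= T]. *)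
have split_exp x : 0 < x -> x `^ r = x `^ e * x `^ (r - e).
  by move=> x0; rewrite -powRD ?(gt_eqF x0) ?implybT// subrKC.
rewrite ler_pdivrMr ?mulr_gt0 ?powR_gt0//.
have -> : T `^ r * (w `^ e * (u `^ (- e) * v `^ (- e))) * (u `^ r * v `^ r) =
    w `^ e * (T `^ r * (u `^ (r - e) * v `^ (r - e))).
  rewrite (split_exp u)// (split_exp v)// !powRN.
  have ue : u `^ e != 0 by rewrite gt_eqF// powR_gt0.
  have ve : v `^ e != 0 by rewrite gt_eqF// powR_gt0.
  by field; rewrite ue ve.
rewrite {1}(split_exp w)// ler_wpM2l ?powR_ge0//.
have re : 0 <= r - e by rewrite subr_ge0.
apply: (@le_trans _ _ ((T * (u * v)) `^ (r - e))).
  by apply: ge0_ler_powR; rewrite ?nnegrE ?mulr_ge0 ?(ltW u0) ?(ltW v0) ?(ltW T0) ?(ltW w0).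
rewrite !powRM ?mulr_ge0 ?(ltW u0) ?(ltW v0) ?(ltW T0)//.
rewrite ler_wpM2r ?mulr_ge0 ?powR_ge0//.
by apply: ler_powR => //; rewrite gerBl.
Qed.

Section Comparison.
Variables (R : realType) (G : groupType) (L : G -> nat).
Hypothesis L1 : L 1%g = 0%N.
Hypothesis LV : forall g, L (g^-1)%g = L g.
Hypothesis LM : forall g h, (L (g * h)%g <= L g + L h)%N.
Hypothesis Lsum : exists2 D : R, 0 < D & (\esum_(g in [set: G]) (D ^- L g)%:E <= 2%:E)%E.

Local Notation F g := ((L g)`!%:R : R).
Local Notation norm1 := (ell1_norm L (fun n : nat => n`!%:R : R)).

Lemma fact_length_ge1 g : 1 <= F g.
Proof. by rewrite ler1n fact_gt0. Qed.

Lemma fact_length_gt0 g : 0 < F g.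
Proof. by rewrite ltr0n fact_gt0. Qed.

Local Hint Resolve fact_length_ge1 fact_length_gt0 : core.

Lemma fact_lengthM g h : F (g * h)%g <= 2 ^+ (L g + L h) * (F g * F h).
Proof.
rewrite -natrX -!natrM ler_nat; apply: leq_trans (leq_factD _ _).
exact/leq_fact/LM.
Qed.

(** Factorials beat exponentials: [(x D)^L(g) <= C F(g)^e] reduces the sum to that of [C D^-L(g)],
    with [D] from the growth of the group. *)
Lemma fact_length_summable (x e : R) : 0 < x -> 0 < e ->
  exists2 M, 0 < M & forall B : {fset G}, \sum_(g <- B) x ^+ L g * F g `^ (- e) <= M.
Proof.
move=> x0 e0; have [D D0 /esum_leP DB] := Lsum.
have [C C0 CE] := expr_le_fact_powR (mulr_gt0 x0 D0) e0.
exists (C * 2) => [|B]; first by rewrite mulr_gt0.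
apply: (@le_trans _ _ (\sum_(g <- B) C * D ^- L g)); last first.
  by rewrite -mulr_sumr ler_wpM2l// ltW.
apply: ler_sum => g _; rewrite powRN ler_pdivrMr ?powR_gt0// mulrAC.
by rewrite ler_pdivlMr ?exprn_gt0// -exprMn.
Qed.

Variable rho : R.
Hypothesis rho0 : 0 < rho.
Implicit Type a : group_algebra R G.

Local Notation c := (bw_c L rho).
Local Notation h := (bw_h L rho).

Lemma bw_c_gt0 g : 0 < c g.
Proof. exact: powR_gt0. Qed.
Local Hint Resolve bw_c_gt0 : core.

Lemma bw_h_ge0 a m l k : (0 <= h a m l k)%E.
Proof.
elim: m l k => [|m IH] l k /=; first by rewrite lee_fin mulr_ge0 ?normc_ge0// ltW.
apply: esum_ge0 => g _; apply: mule_ge0; first by apply: mule_ge0; exact: IH.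
by rewrite lee_fin divr_ge0 ?mulr_ge0 ?(ltW (bw_c_gt0 _)).
Qed.

(** With [q = g^-1 k], the exponential in [L(q)] is absorbed by [F(q)^-e], so [C] depends on neither
    [g] nor [k]. The exponential in [L(g)] is kept for the summation over [g]. *)
Lemma bw_c_quot_le (e : R) : 0 < e <= rho -> exists2 C, 0 < C & forall g k,
  c k / (c g * c (g^-1 * k)%g) <= C * F k `^ e * ((2 `^ rho) ^+ L g * F g `^ (- e)).
Proof.
move=> /andP[e0 er].
have p0 : 0 < 2 `^ rho :> R by exact: powR_gt0.
have [C C0 CE] := expr_le_fact_powR p0 e0.
exists C => // g k; set q := (g^-1 * k)%g.
have kE : k = (g * q)%g by rewrite /q mulgA mulgV mul1g.
have hk := fact_lengthM g q; rewrite -kE in hk.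
have T1 : 1 <= 2 ^+ (L g + L q) :> R by rewrite exprn_ege1// ler1n.
have e01 : 0 <= e <= rho by rewrite (ltW e0).
apply: le_trans (powR_quot_le T1 _ _ _ hk e01) _ => //.
rewrite powR_exprn// exprD.
have := CE (L q); rewrite -ler_pdivrMr ?powR_gt0// -powRN => hq.
rewrite [leLHS](_ : _ = ((2 `^ rho) ^+ L q * F q `^ (- e)) *
   (F k `^ e * ((2 `^ rho) ^+ L g * F g `^ (- e)))); last by ring.
by rewrite -[leRHS]mulrA ler_wpM2r// !mulr_ge0 ?powR_ge0 ?exprn_ge0.
Qed.

(** The induction needs all [e] at once, because level [m + 1] calls level [m] with [e / 4]; the
    loss [d] thus shrinks with [m]. The power [N ^+ (2 ^ m)] reflects the homogeneity of [h], and
    [C] and [d] are uniform in [a]. *)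
Lemma bw_h_bound m (e : R) : 0 < e <= rho ->
  exists C d, [/\ 0 < C, 0 < d <= rho & forall a N l k, (norm1 (rho - d) a <= N%:E)%E ->
    (h a m l k <= (C * F k `^ e * N ^+ (2 ^ m))%:E)%E].
Proof.
elim: m e => [|m IH] e /andP[e0 er].
  (* One term of the norm bounds [normc (a k)] times [F(k)^(rho - e)]; the weight [c(k) = F(k)^rho]
     supplies the remaining [F(k)^e]. *)
  exists 1, e; rewrite e0 er; split => // a N l k /esum_leP/(_ [fset k]%fset).
  rewrite big_seq_fset1 => hN; rewrite /= lee_fin mul1r expn0 expr1 /bw_c.
  rewrite -[in F k `^ rho](subrK e rho) powRD ?(gt_eqF (fact_length_gt0 k)) ?implybT//.
  by rewrite mulrA mulrC ler_wpM2l ?powR_ge0.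
have e4 : 0 < e / 4 <= rho by apply/andP; split; [rewrite divr_gt0|lra].
have [C [d [C0 d0 Cd]]] := IH _ e4.
have [C2 C20 quot] := @bw_c_quot_le e (introT andP (conj e0 er)).
have e2 : 0 < e / 2 by rewrite divr_gt0.
have p0 : 0 < 2 `^ rho :> R by exact: powR_gt0.
have [M M0 ME] := fact_length_summable p0 e2.
exists (C ^+ 2 * C2 * M), d; split => // [|a N l k hN].
  by rewrite !mulr_gt0// exprn_gt0.
rewrite /=; set k' := if _ then _ else _.
(* An odd index only replaces [k] by its inverse, which has the same length. *)
have Fk : F k' = F k by rewrite /k'; case: ifP; rewrite ?LV.
have N0 : 0 <= N by rewrite -lee_fin; apply: le_trans hN; exact: ell1_norm_ge0.
pose f g := (C ^+ 2 * C2 * F k `^ e * N ^+ (2 ^ m.+1)) *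
  ((2 `^ rho) ^+ L g * F g `^ (- (e / 2))).
apply: (@le_trans _ _ (\esum_(g in [set: G]) (f g)%:E)%E); last first.
  apply/esum_leP => B; rewrite /f -mulr_sumr.
  rewrite [leRHS](_ : _ = C ^+ 2 * C2 * F k `^ e * N ^+ (2 ^ m.+1) * M); last by ring.
  by rewrite ler_wpM2l// !mulr_ge0 ?exprn_ge0 ?powR_ge0 ?(ltW C0) ?(ltW C20).
apply: le_esum => g _.
have := Cd a N l./2 g hN; have := bw_h_ge0 a m l./2 g.
case: (h a m l./2 g) => [r| |]//; rewrite !lee_fin => r0 rle.
rewrite -expr2.
have q0 : 0 <= c k' / (c g * c (g^-1 * k')%g) by rewrite divr_ge0 ?mulr_ge0 ?(ltW (bw_c_gt0 _)).
apply: (@le_trans _ _ ((C * F g `^ (e / 4) * N ^+ (2 ^ m)) ^+ 2 *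
   (C2 * F k' `^ e * ((2 `^ rho) ^+ L g * F g `^ (- e))))).
  apply: ler_pM => //; first by rewrite exprn_ge0.
  by rewrite lerXn2r// nnegrE (le_trans r0).
rewrite Fk /f expnS mulnC exprM.
have -> : F g `^ (- (e / 2)) = F g `^ (e / 4) ^+ 2 * F g `^ (- e).
  rewrite -powR_mulrn ?powR_ge0// -powRrM -powRD ?(gt_eqF (fact_length_gt0 g)) ?implybT//.
  by congr (_ `^ _); field.
by rewrite le_eqVlt; apply/orP; left; apply/eqP; ring.
Qed.

Lemma bw_c1 : c 1%g = 1.
Proof. by rewrite /bw_c L1 fact0 powR1. Qed.

Lemma bw_c_inv g : c (g^-1)%g = c g.
Proof. by rewrite /bw_c LV. Qed.

(** The term [g = k] of the recursion has weight [c(k) / (c(k) c(1)) = 1], so the value at [k] is at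
    least squared at every level. *)
Lemma bw_h_diag a m k : (((normc (a k) * c k) ^+ (2 ^ m))%:E <= h a m 0 k)%E.
Proof.
elim: m => [|m IH] //=.
apply: le_trans (le_esum_term _ k); rewrite mulVg bw_c1 mulr1 divff ?gt_eqF// mule1.
rewrite expnS mulnC exprM EFin_expe.
have x0 : (0 <= ((normc (a k) * c k) ^+ (2 ^ m))%:E)%E.
  by rewrite lee_fin exprn_ge0// mulr_ge0 ?normc_ge0// ltW.
by rewrite !expe2; exact: lee_pmul.
Qed.

(** At [k = 1] each [g] contributes with weight [c(1) / (c(g) c(g^-1)) = 1 / c(g)^2]; this single
    quantity therefore controls all coefficients simultaneously. *)
Lemma bw_h_unit a m g :
  (((normc (a g) * c g) ^+ (2 ^ m.+1) / c g ^+ 2)%:E <= h a m.+1 0 1%g)%E.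
Proof.
rewrite [h _ _ _ _]/=; apply: le_trans (le_esum_term _ g).
rewrite mulg1 bw_c1 bw_c_inv mul1r -expr2 EFinM.
rewrite expnS mulnC exprM EFin_expe.
have x0 : (0 <= ((normc (a g) * c g) ^+ (2 ^ m))%:E)%E.
  by rewrite lee_fin exprn_ge0// mulr_ge0 ?normc_ge0// ltW.
apply: lee_pmul; rewrite ?expe2 ?mule_ge0// ?lee_fin ?invr_ge0 ?exprn_ge0 ?(ltW (bw_c_gt0 _))//.
by apply: lee_pmul => //; exact: bw_h_diag.
Qed.

Local Notation bw := (@bw_seminorm R G L rho).
Local Notation gnorm := (@ga_ell1_norm R G L (fun n : nat => n`!%:R : R) rho).

Lemma powR_inv_exp2 (x : R) m : 0 <= x -> (x ^+ (2 ^ m)) `^ ((2 ^+ m)^-1) = x.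
Proof.
move=> x0; rewrite -powR_mulrn// -powRrM natrX mulfV ?powRr1// expf_neq0// pnatr_eq0.
Qed.

(** The index [k] is fixed here, so [bw_h_bound] may be used at the full exponent [rho], with
    [F(k)^rho] going into the constant. The root of order [2^m] makes the bound linear in the
    norm. *)
Lemma bw_seminorm_le_ell1 (i : bw_index G) : exists (e : ell1_index rho) (C : R),
  0 < C /\ forall a, (bw i a <= C%:E * gnorm e a)%E.
Proof.
case: i => -[m l] k.
have rr : 0 < rho <= rho by rewrite rho0 lexx.
have [C [d [C0 d0 Cd]]] := bw_h_bound m rr.
exists (exist _ d d0), ((C * F k `^ rho) `^ ((2 ^+ m)^-1)).
have K0 : 0 < C * F k `^ rho by rewrite mulr_gt0// powR_gt0.
split => [|a]; first exact: powR_gt0.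
have nfin : gnorm (exist _ d d0) a \is a fin_num.
  rewrite ge0_fin_numE ?ell1_norm_ge0//.
  by have := ga_in_ell1_minus L (fun n => n`!%:R : R) rho a; rewrite inE => /(_ (exist _ d d0) I).
have := ell1_norm_ge0 L (fun n => n`!%:R : R) (rho - d) a.
rewrite -[ell1_norm _ _ _ _]/(gnorm (exist _ d d0) a) -(fineK nfin).
set N := fine _; rewrite lee_fin => N0.
have hN : (norm1 (rho - d) a <= N%:E)%E by rewrite /N fineK.
have := Cd a N l k hN; rewrite /bw_seminorm /=; have := bw_h_ge0 a m l k.
case: (h a m l k) => [x| |]//; rewrite 2!lee_fin => x0 xle.
rewrite poweR_EFin -EFinM lee_fin -[in leRHS](powR_inv_exp2 m N0).
rewrite -powRM ?exprn_ge0 ?(ltW K0)//.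
by apply: ge0_ler_powR; rewrite ?nnegrE ?mulr_ge0 ?exprn_ge0 ?invr_ge0 ?(ltW K0) ?(ltW C0) ?powR_ge0.
Qed.

Lemma ell1_le_bw_seminorm (e : ell1_index rho) : exists (i : bw_index G) (C : R),
  0 < C /\ forall a, (gnorm e a <= C%:E * bw i a)%E.
Proof.
case: e => e e0'; have /andP[e0 er] := e0'.
(* This gives [2 rho / e < 2^m]: the loss [rho / 2^m] caused by the unit term is at most [e / 2],
   and the other half of [e] pays for the summation. *)
pose m := Num.bound (2 * rho / e).
have hm : rho / 2 ^+ m <= e / 2.
  have := upper_nthrootP (leqnn m); rewrite ltr_pdivrMr// => hh.
  by rewrite ler_pdivrMr ?exprn_gt0//; lra.
have e2 : 0 < e / 2 by rewrite divr_gt0.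
have [M M0 ME] := fact_length_summable ltr01 e2.
have p0 : (0 < 2 ^ m.+1)%N by rewrite expn_gt0.
exists (Tagged (fun m => 'I_(2 ^ m)) (Ordinal p0), 1%g), M; split => // a.
rewrite -[bw _ a]/(h a m.+1 0 1%g `^ ((2 ^+ m.+1)^-1))%E.
have := bw_h_ge0 a m.+1 0 1%g; have := bw_h_unit a m.
(* An infinite value of the extended-valued recursion makes the right-hand side infinite. *)
case: (h a m.+1 0 1%g) => [x| |] hx // x0; last first.
  by rewrite poweRyr ?invr_eq0 ?expf_neq0// ?pnatr_eq0// gt0_muley ?leey// lte_fin.
rewrite poweR_EFin -EFinM; apply/esum_leP => B.
pose s := x `^ ((2 ^+ m.+1)^-1).
have s0 : 0 <= s by exact: powR_ge0.
apply: (@le_trans _ _ (\sum_(g <- B) s * (1 ^+ L g * F g `^ (- (e / 2))))); last first.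
  by rewrite -mulr_sumr mulrC ler_wpM2r.
apply: ler_sum => g _; rewrite expr1n mul1r.
have := hx g; rewrite lee_fin ler_pdivrMr ?exprn_gt0// => hg.
have cg0 := ltW (bw_c_gt0 g).
have y0 : 0 <= normc (a g) * c g by rewrite mulr_ge0 ?normc_ge0.
(* Taking the root of order [2^(m+1)] turns the factor [c(g)^2] into [c(g)^(2^-m)]. *)
have : normc (a g) * c g <= s * c g `^ ((2 ^+ m)^-1).
  rewrite -[leLHS](powR_inv_exp2 m.+1 y0).
  have -> : c g `^ ((2 ^+ m)^-1) = (c g ^+ 2) `^ ((2 ^+ m.+1)^-1).
    rewrite -(@powR_mulrn _ (c g) 2 cg0) -powRrM exprS invfM mulrA divff ?mul1r//.
  rewrite -powRM ?exprn_ge0//.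
  by apply: ge0_ler_powR; rewrite ?nnegrE ?mulr_ge0 ?exprn_ge0 ?invr_ge0.
move=> hle.
have -> : F g `^ (rho - e) = c g * F g `^ (- e).
  by rewrite -powRD ?(gt_eqF (fact_length_gt0 g)) ?implybT.
rewrite mulrA; apply: le_trans (ler_wpM2r (powR_ge0 _ _) hle) _.
rewrite -mulrA ler_wpM2l// -powRrM -powRD ?(gt_eqF (fact_length_gt0 g)) ?implybT//.
by apply: ler_powR => //; lra.
Qed.

End Comparison.

(** * The convolution algebra of finitely supported functions *)

Section GaMul.
Variables (R : realType) (G : groupType).
Implicit Types a b c : group_algebra R G.

Lemma ga_eqP a b : a =1 b -> a = b.
Proof. by move=> ab; apply/val_inj/funext. Qed.

Definition ga_supp a : {fset G} := fset_set [set g | a g != 0].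

Lemma ga_suppP a g : g \notin ga_supp a -> a g = 0.
Proof.
have fa := ga_coefP a; rewrite inE /= in fa.
by rewrite in_fset_set// notin_setE /= => /negP; rewrite negbK => /eqP.
Qed.

(** Freedom in the choice of [X] lets several convolutions be summed over one common index set. *)
Lemma ga_mulE (X : {fset G}) a b k : (forall g, g \notin X -> a g = 0) ->
  ga_mul a b k = \sum_(g <- X) a g * b (g^-1 * k)%g.
Proof.
move=> aX; rewrite /= /convolution (fsbigTE X)// => g gX.
by rewrite aX// mul0r.
Qed.

Lemma ga_mul_linearl b : linear ((@ga_mul R G)^~ b).
Proof.
move=> x a a'; apply: ga_eqP => k.
pose X := (ga_supp a `|` ga_supp a')%fset.
have aX g : g \notin X -> a g = 0 /\ a' g = 0.
  by rewrite !inE negb_or => /andP[/ga_suppP -> /ga_suppP ->].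
rewrite (ga_mulE (X := X)); last first.
  move=> g /aX[ag a'g]; rewrite -[LHS]/(x * a g + a' g).
  by rewrite ag a'g mulr0 addr0.
rewrite -[RHS]/(x * ga_mul a b k + ga_mul a' b k).
rewrite !(ga_mulE (X := X)); try by move=> g /aX[].
rewrite mulr_sumr -big_split /=; apply: eq_bigr => g _.
by rewrite -[X in X * _]/(x * a g + a' g) mulrDl mulrA.
Qed.

Lemma ga_mul_linearr a : linear (ga_mul a).
Proof.
move=> x b b'; apply: ga_eqP => k.
rewrite -[RHS]/(x * ga_mul a b k + ga_mul a b' k).
rewrite !(ga_mulE _ _ (@ga_suppP a)) mulr_sumr -big_split /=; apply: eq_bigr => g _.
rewrite -[X in _ * X]/(x * b (g^-1 * k)%g + b' (g^-1 * k)%g).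
by rewrite mulrDr mulrCA.
Qed.

Lemma ga_mulA : associative (@ga_mul R G).
Proof.
move=> a b c; apply: ga_eqP => k; apply: esym.
(* [X] contains all products of the two supports, hence the support of [ga_mul a b]. *)
pose X := (ga_supp a `|` [fset (g * h)%g | g in ga_supp a, h in ga_supp b])%fset.
have abX x : x \notin X -> ga_mul a b x = 0.
  rewrite inE negb_or => /andP[_ xX].
  rewrite (ga_mulE _ _ (@ga_suppP a)) big_seq big1// => g ga.
  rewrite (@ga_suppP b) ?mulr0//; apply: contra xX => hb.
  apply/imfset2P; exists g => //; exists (g^-1 * x)%g => //.
  by rewrite mulgA mulgV mul1g.
rewrite (ga_mulE _ _ abX) (ga_mulE _ _ (@ga_suppP a)).
under eq_bigr do rewrite (ga_mulE _ _ (@ga_suppP a)) mulr_suml.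
rewrite exchange_big /= big_seq [RHS]big_seq; apply: eq_bigr => g ga.
(* For fixed [g], left translation replaces the summation variable of [ga_mul b c] by the product
   [x] of the first two factors. *)
rewrite /convolution (reindex_fsbigT (fun x => g^-1 * x)%g); last first.
  by exists (fun x => g * x)%g => x; rewrite mulgA ?mulgV ?mulVg mul1g.
rewrite (fsbigTE X) ?mulr_sumr; last first.
  move=> x; rewrite inE negb_or => /andP[_ xX].
  rewrite (@ga_suppP b) ?mul0r//; apply: contra xX => hb.
  apply/imfset2P; exists g => //; exists (g^-1 * x)%g => //.
  by rewrite mulgA mulgV mul1g.
apply: eq_bigr => x _; rewrite -mulrA; congr (_ * (_ * c _)).
by rewrite invgM invgK -mulgA mulVKg.
Qed.

Lemma normc_sum (I : Type) (s : seq I) (f : I -> R[i]) :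
  normc (\sum_(j <- s) f j) <= \sum_(j <- s) normc (f j).
Proof.
elim: s => [|j s IH]; first by rewrite !big_nil normc0.
by rewrite !big_cons (le_trans (le_normcD _ _))// lerD2l.
Qed.

End GaMul.

(** * Continuity of convolution for the weighted norms *)

Section L1Mul.
Variables (R : realType) (G : groupType) (L : G -> nat).
Hypothesis LM : forall g h, (L (g * h)%g <= L g + L h)%N.
Variable rho : R.

Local Notation F g := ((L g)`!%:R : R).
Local Notation gnorm := (@ga_ell1_norm R G L (fun n : nat => n`!%:R : R) rho).

(** [F] is submultiplicative only up to [2^(L(g) + L(h))]. The gap [s - r] absorbs this exponential,
    at the price of one [C] for each argument. *)
Lemma fact_length_powRM (r s : R) : 0 <= r < s -> exists2 C, 0 < C &
  forall g h, F (g * h)%g `^ r <= C * F g `^ s * F h `^ s.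
Proof.
move=> /andP[r0 rs].
have p0 : 0 < 2 `^ r :> R by exact: powR_gt0.
have e0 : 0 < s - r by rewrite subr_gt0.
have [C C0 CE] := expr_le_fact_powR p0 e0.
exists (C * C) => [|g h]; first by rewrite mulr_gt0.
apply: (@le_trans _ _ ((2 ^+ (L g + L h) * (F g * F h)) `^ r)).
  by apply: ge0_ler_powR; rewrite ?nnegrE ?mulr_ge0 ?exprn_ge0 ?fact_lengthM.
rewrite !powRM ?mulr_ge0 ?exprn_ge0//.
rewrite powR_exprn// exprD.
have Fs x : F x `^ s = F x `^ (s - r) * F x `^ r.
  by rewrite -powRD ?subrK// (gt_eqF (fact_length_gt0 R L x)) implybT.
rewrite !Fs.
rewrite [leLHS](_ : _ = ((2 `^ r) ^+ L g * F g `^ r) * ((2 `^ r) ^+ L h * F h `^ r)); last by ring.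
rewrite [leRHS](_ : _ = (C * F g `^ (s - r) * F g `^ r) * (C * F h `^ (s - r) * F h `^ r)); last by ring.
by apply: ler_pM; rewrite ?mulr_ge0 ?exprn_ge0 ?powR_ge0// ler_wpM2r ?powR_ge0.
Qed.

Lemma ell1_term_le (r N : R) (f : G -> R[i]) (B : {fset G}) :
  (ell1_norm L (fun n : nat => n`!%:R : R) r f <= N%:E)%E ->
  \sum_(g <- B) normc (f g) * F g `^ r <= N.
Proof. by move=> /esum_leP. Qed.

Lemma ga_mul_bound (e : ell1_index rho) : exists (e' : ell1_index rho) (C : R), 0 < C /\
  forall a b (Na Nb : R), (gnorm e' a <= Na%:E)%E -> (gnorm e' b <= Nb%:E)%E ->
    (gnorm e (ga_mul a b) <= (C * Na * Nb)%:E)%E.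
Proof.
case: e => e e0'; have /andP[e0 er] := e0'.
have e2 : 0 < e / 2 <= rho by apply/andP; split; lra.
have rs : 0 <= rho - e < rho - e / 2 by apply/andP; split; lra.
have [C C0 CE] := fact_length_powRM rs.
exists (exist (fun x : R => 0 < x <= rho) _ e2), C; split => // a b Na Nb ha hb.
set r := rho - e in rs CE; set s := rho - e / 2 in rs CE.
apply/esum_leP => B.
have Nb0 : 0 <= Nb by rewrite -lee_fin; apply: le_trans hb; exact: ell1_norm_ge0.
apply: (@le_trans _ _ (\sum_(k <- B) \sum_(g <- ga_supp a)
   (C * (normc (a g) * F g `^ s)) * (normc (b (g^-1 * k)%g) * F (g^-1 * k)%g `^ s))).
  apply: ler_sum => k _; rewrite (ga_mulE _ _ (@ga_suppP _ _ a)).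
  apply: le_trans (ler_wpM2r (powR_ge0 _ _) (normc_sum _ _)) _.
  rewrite mulr_suml; apply: ler_sum => g _; rewrite normcM.
  have := CE g (g^-1 * k)%g; rewrite mulgA mulgV mul1g => h.
  apply: le_trans (ler_wpM2l (mulr_ge0 (normc_ge0 _) (normc_ge0 _)) h) _.
  by rewrite le_eqVlt; apply/orP; left; apply/eqP; ring.
rewrite exchange_big /=.
apply: (@le_trans _ _ (\sum_(g <- ga_supp a) (C * (normc (a g) * F g `^ s)) * Nb)).
  apply: ler_sum => g _; rewrite -mulr_sumr ler_wpM2l ?mulr_ge0 ?normc_ge0 ?powR_ge0 ?(ltW C0)//.
  (* Left translation is injective, so the sum over [k] is a partial sum of the norm of [b]. *)
  have := ell1_term_le [fset (g^-1 * k)%g | k in B]%fset hb.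
  rewrite big_imfset//= => x y _ _; exact: mulgI.
rewrite -mulr_suml -mulr_sumr ler_wpM2r// ler_wpM2l ?(ltW C0)//.
exact: ell1_term_le ha.
Qed.

End L1Mul.

(** * Topologies of dominated families of gauges *)

Lemma gauge_open_dominated (K : numFieldType) (V : lmodType K) (R : realType)
    (I J : choiceType) (p : I -> V -> \bar R) (q : J -> V -> \bar R) :
  (forall i, exists (j : J) (C : R), 0 < C /\ forall x, (p i x <= C%:E * q j x)%E) ->
  forall U : set V, gauge_open (p := p) U -> gauge_open (p := q) U.
Proof.
move=> dom; have {dom}[f fP] := choice dom; have {fP}[C fC] := choice fP.
move=> U oU x /oU[X [e [e0 XU]]].
(* The smallest of the finitely many radii [e / C i] works; the initial value 1 keeps the radius
   positive when [X] is empty. *)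
exists [fset f i | i in X]%fset, (\big[Num.min/1]_(i <- X) (e / C i)); split.
  by elim/big_ind: _ => // [u v u0 v0|i _]; rewrite ?lt_min ?u0// divr_gt0//; have [] := fC i.
move=> y yX; apply: XU => i iX; have [C0 pq] := fC i.
apply: (le_lt_trans (pq _)).
have := yX (f i) (in_imfset _ f iX) => /(@lt_le_trans _ _ _ _ (e / C i)%:E) h.
rewrite muleC -lte_pdivlMr// -EFinM; apply: h.
by rewrite lee_fin; apply: ge_bigmin_seq.
Qed.

Lemma normc_ReB (R : rcfType) (u v : R[i]) : `|complex.Re u - complex.Re v| <= normc (u - v).
Proof.
case: u v => [u1 u2] [v1 v2] /=; rewrite -sqrtr_sqr ler_wsqrtr//.
by rewrite lerDl sqr_ge0.
Qed.

Lemma normc_ImB (R : rcfType) (u v : R[i]) : `|complex.Im u - complex.Im v| <= normc (u - v).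
Proof.
case: u v => [u1 u2] [v1 v2] /=; rewrite -sqrtr_sqr ler_wsqrtr//.
by rewrite lerDr sqr_ge0.
Qed.

Lemma normc_leReIm (R : rcfType) (u : R[i]) :
  normc u <= `|complex.Re u| + `|complex.Im u|.
Proof.
case: u => a b /=; rewrite -[leRHS]ger0_norm ?addr_ge0// -[leRHS]sqrtr_sqr ler_wsqrtr//.
rewrite sqrrD !real_normK ?num_real//.
by rewrite lerD2r lerDl mulrn_wge0// mulr_ge0.
Qed.

(** * The weighted space: separation, density, embedding and completeness *)

Section L1Space.
Variables (R : realType) (G : groupType) (L : G -> nat) (rho : R).
Hypothesis rho0 : 0 < rho.

Local Notation F g := ((L g)`!%:R : R).
Local Notation fct := (fun n : nat => n`!%:R : R).
Local Notation norm1 := (ell1_norm L fct).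
Local Notation l1 := (ell1_minus (R := R) L fct rho).
Local Notation pnorm := (@ell1_minus_norm R G L fct rho).
Local Notation gnorm := (@ga_ell1_norm R G L fct rho).
Local Notation incl := (@ga_ell1_minus R G L fct rho).

Lemma ell1_norm_mono (r s : R) (f : G -> R[i]) : r <= s -> (norm1 r f <= norm1 s f)%E.
Proof.
move=> rs; apply: le_esum => g _; rewrite lee_fin ler_wpM2l ?normc_ge0//.
by apply: ler_powR => //; exact: fact_length_ge1.
Qed.

(** The norms increase as the index decreases, since [1 <= F]; the smallest index dominates, and
    [rho] itself serves for the empty family. Neighbourhoods are thereby described by a single
    norm. *)
Lemma ell1_index_directed (X : seq (ell1_index rho)) : exists e0 : ell1_index rho,
  forall e, e \in X -> forall f, (norm1 (rho - val e) f <= norm1 (rho - val e0) f)%E.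
Proof.
elim: X => [|e X [e0 IH]].
  have rr : 0 < rho <= rho by rewrite rho0 lexx.
  by exists (exist (fun x : R => 0 < x <= rho) _ rr).
have [le|/ltW le] := leP (val e) (val e0).
  exists e => e1; rewrite inE => /orP[/eqP -> //|/IH h f].
  by apply: le_trans (h f) _; apply: ell1_norm_mono; rewrite lerB.
exists e0 => e1; rewrite inE => /orP[/eqP -> f|/IH //].
by apply: ell1_norm_mono; rewrite lerB.
Qed.

Lemma nbhs_l1P (x : l1) (U : set l1) : nbhs x U <->
  exists (e : ell1_index rho) (t : R), 0 < t /\
    forall y : l1, (pnorm e (y - x)%R < t%:E)%E -> U y.
Proof.
have nb := @nbhs_seminormed _ _ _ pnorm (@ell1_minus_norm_fin R G L fct rho)
  (@ell1_minus_normD R G L fct rho) (@ell1_minus_normZ R G L fct rho) x U.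
split=> [/nb[X [t [t0 XU]]]|[e [t [t0 tU]]]].
  have [e0 he] := ell1_index_directed X; exists e0, t; split => // y yt.
  by apply: XU => i iX; apply: le_lt_trans yt; exact: he.
apply/nb; exists [fset e]%fset, t; split => // y yt.
by apply: tU; exact: yt (fset11 e).
Qed.

Lemma l1_coef_le (e : ell1_index rho) (x : l1) g (t : R) :
  (pnorm e x <= t%:E)%E -> normc ((x : ell1_minus_carrier L fct rho) g) <= t.
Proof.
move=> /(ell1_term_le [fset g]%fset); rewrite big_seq_fset1; apply: le_trans.
rewrite ler_peMr ?normc_ge0//.
have e1 := valP e; rewrite -[leLHS](powRr0 (F g)); apply: ler_powR; first exact: fact_length_ge1.
by rewrite subr_ge0; case/andP: e1.
Qed.

Lemma l1_coef_lt (e : ell1_index rho) (x : l1) g (t : R) :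
  (pnorm e x < t%:E)%E -> normc ((x : ell1_minus_carrier L fct rho) g) < t.
Proof.
rewrite -[pnorm e x]fineK ?ell1_minus_norm_fin// lte_fin; apply: le_lt_trans.
by apply: (@l1_coef_le e); rewrite fineK ?ell1_minus_norm_fin.
Qed.

Lemma l1_hausdorff : hausdorff_space l1.
Proof.
move=> x y xy; apply/val_inj/funext => g; apply/eqP; rewrite -subr_eq0; apply/eqP/eq0_normc.
apply/eqP; rewrite eq_le normc_ge0 andbT; apply/ler_addgt0Pl => t t0; rewrite addr0.
have rr : 0 < rho <= rho by rewrite rho0 lexx.
pose e : ell1_index rho := exist (fun x : R => 0 < x <= rho) _ rr.
have t20 : 0 < t / 2 by rewrite divr_gt0.
pose bl (z : l1) : set l1 := [set w | (pnorm e (w - z)%R < (t / 2)%:E)%E].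
have nbl z : nbhs z (bl z) by apply/nbhs_l1P; exists e, (t / 2).
have [w [wx wy]] := xy _ _ (nbl x) (nbl y).
have hx := @l1_coef_le e (w - x) g (t / 2) (ltW wx).
have hy := @l1_coef_le e (w - y) g (t / 2) (ltW wy).
have -> : val x g - val y g = - (val w g - val x g) + (val w g - val y g) by ring.
by rewrite (le_trans (le_normcD _ _))// normcN [t]splitr lerD.
Qed.

Lemma inclB (a b : group_algebra R G) e : pnorm e (incl a - incl b) = gnorm e (a - b).
Proof. by []. Qed.

Lemma incl_linear : linear incl.
Proof. by move=> k a b; exact/val_inj. Qed.

Lemma ga_truncate (f : G -> R[i]) (A : {fset G}) :
  exists a : group_algebra R G, forall g, a g = if g \in A then f g else 0.
Proof.
have aP : (fun g => if g \in A then f g else 0) \in @finitely_supported R G.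
  rewrite inE; apply: (@sub_finite_set _ _ [set` A]) => // g /=.
  by case: ifP => // _; rewrite eqxx.
by exists (GroupAlgebra aP).
Qed.

Lemma ell1_norm_truncate (r t : R) (f : G -> R[i]) : (norm1 r f < +oo)%E -> 0 < t ->
  exists a : group_algebra R G, (norm1 r ((a : G -> R[i]) - f)%R < t%:E)%E.
Proof.
move=> ffin t0; have t20 : 0 < t / 2 by rewrite divr_gt0.
have nf : norm1 r f \is a fin_num by rewrite ge0_fin_numE ?ell1_norm_ge0.
have [A hA] : exists A : {fset G}, fine (norm1 r f) - t / 2 < \sum_(g <- A) normc (f g) * F g `^ r.
  apply: contrapT => /forallNP nA.
  have : (norm1 r f <= (fine (norm1 r f) - t / 2)%:E)%E.
    by apply/esum_leP => B; have /negP := nA B; rewrite -leNgt.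
  by rewrite -{1}(fineK nf) lee_fin; lra.
have [a aE] := ga_truncate f A; exists a.
apply: (@le_lt_trans _ _ (t / 2)%:E); last by rewrite lte_fin; lra.
apply/esum_leP => B.
have hN : \sum_(g <- (A `|` B)%fset) normc (f g) * F g `^ r <= fine (norm1 r f).
  by apply: ell1_term_le; rewrite fineK.
set C := (A `|` B)%fset in hN.
have restrict (X : {fset G}) (v : G -> R) : (X `<=` C)%fset ->
    \sum_(g <- X) v g = \sum_(g <- C) if g \in X then v g else 0.
  move=> XC; rewrite -(big_fset_incl _ XC) => [|g _ /negbTE -> //].
  by rewrite big_seq [RHS]big_seq; apply: eq_bigr => g ->.
rewrite restrict ?fsubsetUl// in hA; rewrite restrict ?fsubsetUr//.
(* The difference [a - f] vanishes on [A] and equals [-f] off [A]. Its sum over [B] and the sum of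
   [f] over [A] thus fit together inside the sum over [C], which is at most the norm of [f]. *)
suff : \sum_(g <- C) (if g \in B then normc (((a : G -> R[i]) - f) g) * F g `^ r else 0) +
    \sum_(g <- C) (if g \in A then normc (f g) * F g `^ r else 0) <=
    \sum_(g <- C) normc (f g) * F g `^ r by lra.
rewrite -big_split /=; apply: ler_sum => g _.
have v0 : 0 <= normc (f g) * F g `^ r by rewrite mulr_ge0 ?normc_ge0 ?powR_ge0.
rewrite -[(_ - f) g]/(a g - f g) aE; case: ifP; case: ifP => //= _ _;
  by rewrite ?subrr ?sub0r ?normcN ?normc0 ?mul0r ?add0r ?addr0.
Qed.

Lemma incl_dense : dense (range incl).
Proof.
move=> U [x Ux] oU.
have /nbhs_l1P[e [t [t0 tU]]] : nbhs x U by exact: open_nbhs_nbhs.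
have xfin : (norm1 (rho - val e) (val x) < +oo)%E.
  by have := ell1_minus_norm_fin e x; rewrite ge0_fin_numE ?ell1_norm_ge0.
have [a ha] := ell1_norm_truncate xfin t0.
by exists (incl a); split; [exact: tU|exists a].
Qed.

(** A ball of the weighted space around [incl a] has the corresponding ball around [a] as its trace.
    An open [U] is therefore the trace of the union of all balls of the weighted space whose traces
    lie in [U]. *)
Lemma incl_embedding (U : set (group_algebra R G)) :
  gauge_open (p := gnorm) U <-> exists2 D : set l1, open D & U = incl @^-1` D.
Proof.
have nb := @gauge_ball_open _ _ _ pnorm (@ell1_minus_norm_fin R G L fct rho)
  (@ell1_minus_normD R G L fct rho).
split=> [oU|[D oD ->] a Da].
  pose I : Type := {x : group_algebra R G * ({fset ell1_index rho} * R) |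
    0 < x.2.2 /\ gauge_ball gnorm x.1 x.2.1 x.2.2 `<=` U}.
  pose W (i : I) : set l1 := gauge_ball pnorm (incl (sval i).1) (sval i).2.1 (sval i).2.2.
  exists (\bigcup_i W i); first by apply: bigcup_open => i _; exact: nb.
  apply/seteqP; split=> [x Ux|x [[[a [X e]] /= [e0 XU]] _ Wx]].
    have [X [e [e0 XU]]] := oU x Ux.
    exists (exist _ (x, (X, e)) (conj e0 XU)) => // i iX /=.
    rewrite subrr /ell1_minus_norm /ell1_norm esum1 ?lte_fin// => g _.
    by rewrite normc0 mul0r.
  exact: (XU x Wx).
have /nbhs_l1P[e [t [t0 tU]]] : nbhs (incl a) D by exact: open_nbhs_nbhs.
exists [fset e]%fset, t; split => // b hb; apply: tU.
exact: hb (fset11 e).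
Qed.

(** The limit [z] is built coefficient by coefficient; the Cauchy condition on finite partial sums
    then yields convergence in every norm, and [z] has finite norms because some [x - z] does. *)
Lemma l1_complete : tvs_complete l1.
Proof.
move=> Phi PPhi cauchyPhi.
have small e (t : R) : 0 < t -> exists2 B : set l1, Phi B &
    forall x y, B x -> B y -> (pnorm e (x - y)%R < t%:E)%E.
  move=> t0; have [|B PB hB] := cauchyPhi [set x | (pnorm e x < t%:E)%E].
    by apply/nbhs_l1P; exists e, t; split => // y; rewrite subr0.
  by exists B.
have rr : 0 < rho <= rho by rewrite rho0 lexx.
pose er : ell1_index rho := exist (fun x : R => 0 < x <= rho) _ rr.
(* Each coefficient is dominated by the norm of index [rho], whose weight is [F^0 = 1]. Real and
   imaginary parts are treated separately so as to use the completeness of [R]. *)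
have coordinate (phi : R[i] -> R) : (forall u v, `|phi u - phi v| <= normc (u - v)) ->
    forall g, exists l : R, forall t : R, 0 < t -> Phi [set x : l1 | `|phi (val x g) - l| < t].
  move=> lip g; have : cauchy ((fun x : l1 => phi (val x g)) @ Phi).
    apply: cauchy_exP => t t0; have [B PB hB] := small er t t0.
    have [x Bx] := filter_ex PB; exists (phi (val x g)).
    suff : Phi [set y : l1 | ball (phi (val x g)) t (phi (val y g))] by [].
    apply: filterS PB => y By; rewrite /= -ball_normE /=.
    exact: le_lt_trans (lip _ _) (@l1_coef_lt er (x - y) g t (hB _ _ Bx By)).
  move=> /cauchy_cvg/cvg_ex[l hl]; exists l => t t0.
  have : Phi [set y : l1 | ball l t (phi (val y g))] := hl _ (nbhsx_ballx l t t0).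
  by apply: filterS => x; rewrite /= -ball_normE /= distrC.
have [re hre] := choice (coordinate (@complex.Re R) (@normc_ReB _)).
have [im him] := choice (coordinate (@complex.Im R) (@normc_ImB _)).
pose z g : R[i] := (re g +i* im g)%C.
have coordz g (t : R) : 0 < t -> Phi [set x : l1 | normc (val x g - z g) < t].
  move=> t0; have t20 : 0 < t / 2 by rewrite divr_gt0.
  apply: filterS (filterI (hre g _ t20) (him g _ t20)) => x [h1 h2].
  apply: le_lt_trans (normc_leReIm _) _; move: h1 h2 => /=.
  by case: (val x g) => u1 u2 /=; lra.
have sumz r (s : seq G) (t : R) : 0 < t ->
    Phi [set x : l1 | \sum_(g <- s) normc (val x g - z g) * F g `^ r < t].
  elim: s t => [|g s IH] t t0.
    by apply: filterS filterT => x _ /=; rewrite big_nil.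
  have t20 : 0 < t / 2 by rewrite divr_gt0.
  have F0 : 0 < F g `^ r by rewrite powR_gt0// fact_length_gt0.
  apply: filterS (filterI (coordz g _ (divr_gt0 t20 F0)) (IH _ t20)) => x [/=].
  by rewrite big_cons ltr_pdivlMr// => h1 h2; lra.
have tail (e : ell1_index rho) (t : R) : 0 < t -> exists2 B : set l1, Phi B &
    forall x : l1, B x -> (norm1 (rho - val e) (val x - z)%R <= t%:E)%E.
  move=> t0; have [B PB hB] := small e t t0; exists B => // x Bx.
  apply/esum_leP => X; apply/ler_addgt0Pr => d d0.
  (* [B] is fixed before the finite set [X], whereas [y] depends on [X] and [d]; the resulting bound
     [t + d] is uniform in [X], and [d] is arbitrary. *)
  have [y [By hy]] := filter_ex (filterI PB (sumz (rho - val e) X d d0)).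
  have hxy : \sum_(g <- X) normc (val x g - val y g) * F g `^ (rho - val e) <= t.
    exact: (ell1_term_le X (ltW (hB x y Bx By))).
  apply: le_trans (lerD hxy (ltW hy)); rewrite -big_split /=.
  apply: ler_sum => g _; rewrite -mulrDl ler_wpM2r ?powR_ge0//.
  by apply: le_trans (le_normcD _ _); rewrite addrA subrK.
have zP : z \in @ell1_minus_pred R G L fct rho.
  rewrite inE => e _; have [B PB hB] := tail e 1 ltr01.
  have [x Bx] := filter_ex PB.
  have -> : z = val x + (-1) *: (val x - z).
    by rewrite scaleN1r opprB addrC subrK.
  apply: le_lt_trans (ell1_normD _ _ _ _ _) _.
  rewrite lte_add_pinfty//.
    by have := ell1_minus_norm_fin e x; rewrite ge0_fin_numE ?ell1_norm_ge0.
  apply: le_lt_trans (ell1_normZ _ _ _ _ _) _.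
  by rewrite lte_mul_pinfty ?lee_fin ?normc_ge0// (le_lt_trans (hB x Bx))// ltry.
exists (Ell1Minus zP : l1) => U /nbhs_l1P[e [t [t0 tU]]].
have t20 : 0 < t / 2 by rewrite divr_gt0.
have [B PB hB] := tail e _ t20.
apply: filterS PB => x Bx; apply: tU.
by apply: le_lt_trans (hB x Bx) _; rewrite lte_fin; lra.
Qed.

End L1Space.

(** * Algebra laws on a space with a dense subalgebra *)

Section DenseLaw.
Variables (K : numFieldType) (V : lmodType K) (mulV : V -> V -> V).
Variables (A : tvsType K) (mul : A -> A -> A) (iota : V -> A).
Hypothesis hA : hausdorff_space A.
Hypothesis dA : dense (range iota).
Hypothesis lin : linear iota.
Hypothesis cmul : continuous (fun z : A * A => mul z.1 z.2).
Hypothesis morph : {morph iota : a b / mulV a b >-> mul a b}.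

(** Both sides of each law are continuous in all their variables and agree on the dense image of
    triples from [V]. *)
Lemma dense_algebra_law : associative mulV -> (forall b, linear (mulV^~ b)) ->
  (forall a, linear (mulV a)) -> topological_algebra_law mul.
Proof.
move=> mulVA mulVl mulVr.
have d2 := dense_range_pair dA dA; have d3 := dense_range_pair d2 dA.
have c1 := @continuous_fst (A * A)%type A; have c3 := @continuous_snd (A * A)%type A.
have c11 := continuous_comp_fun c1 (@continuous_fst A A).
have c12 := continuous_comp_fun c1 (@continuous_snd A A).
have cadd : continuous (fun z : A * A => z.1 + z.2) by exact: add_continuous.
have cZ k : continuous (fun z : A => k *: z) := @continuous_scaler K A k.
split => //.
- move=> x y z.
  have cl := continuous_pair_comp cmul c11 (continuous_pair_comp cmul c12 c3).
  have cr := continuous_pair_comp cmul (continuous_pair_comp cmul c11 c12) c3.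
  apply: (dense_continuous_eq hA d3 cl cr _ (x, y, z)) => -[[u v] w] /=.
  by rewrite -!morph mulVA.
- move=> z k x y.
  have cl := continuous_pair_comp cmul
    (continuous_pair_comp cadd (continuous_comp_fun c11 (cZ k)) c12) c3.
  have cr := continuous_pair_comp cadd
    (continuous_comp_fun (continuous_pair_comp cmul c11 c3) (cZ k))
    (continuous_pair_comp cmul c12 c3).
  apply: (dense_continuous_eq hA d3 cl cr _ (x, y, z)) => -[[u v] w] /=.
  by rewrite -lin -!morph -lin -mulVl.
- move=> z k x y.
  have cl := continuous_pair_comp cmul c3
    (continuous_pair_comp cadd (continuous_comp_fun c11 (cZ k)) c12).
  have cr := continuous_pair_comp cadd
    (continuous_comp_fun (continuous_pair_comp cmul c3 c11) (cZ k))
    (continuous_pair_comp cmul c3 c12).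
  apply: (dense_continuous_eq hA d3 cl cr _ (x, y, z)) => -[[u v] w] /=.
  by rewrite -lin -!morph -lin -mulVr.
Qed.

End DenseLaw.

(** * The product of the weighted space *)

Section L1Algebra.
Variables (R : realType) (G : groupType) (L : G -> nat) (rho : R).
Hypothesis rho0 : 0 < rho.
Hypothesis LM : forall g h, (L (g * h)%g <= L g + L h)%N.

Local Notation F g := ((L g)`!%:R : R).
Local Notation fct := (fun n : nat => n`!%:R : R).
Local Notation l1 := (ell1_minus (R := R) L fct rho).
Local Notation pnorm := (@ell1_minus_norm R G L fct rho).
Local Notation incl := (@ga_ell1_minus R G L fct rho).

Lemma l1_norm_tri e (x y z : l1) (s t : R) : (pnorm e (x - y)%R <= s%:E)%E ->
  (pnorm e (y - z)%R <= t%:E)%E -> (pnorm e (x - z)%R <= (s + t)%:E)%E.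
Proof.
move=> hs ht; rewrite -(subrK y x) -addrA EFinD.
exact: le_trans (ell1_minus_normD _ _ _) (leeD hs ht).
Qed.

Lemma l1_norm_sym e (x y : l1) : pnorm e (x - y) = pnorm e (y - x).
Proof.
apply: eq_esum => g _; rewrite -[in LHS]opprB.
by congr (_ * _)%:E; rewrite -[RHS]normcN.
Qed.

(** This splitting bounds the variation of a product by variations of its factors, which is the
    Cauchy estimate needed to extend it. *)
Lemma ga_mulBB (a b a' b' : group_algebra R G) :
  ga_mul a b - ga_mul a' b' = ga_mul (a - a') b + ga_mul a' (b - b').
Proof.
have Bl u v w : ga_mul (u - v) w = ga_mul u w - ga_mul v w :> group_algebra R G.
  by rewrite -scaleN1r addrC (ga_mul_linearl w) scaleN1r addrC.
have Br u v w : ga_mul w (u - v) = ga_mul w u - ga_mul w v :> group_algebra R G.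
  by rewrite -scaleN1r addrC (ga_mul_linearr w) scaleN1r addrC.
by rewrite Bl Br addrA subrK.
Qed.

Lemma l1_mul_exists : exists mul : l1 -> l1 -> l1,
  topological_algebra_law mul /\ {morph incl : a b / ga_mul a b >-> mul a b}.
Proof.
pose f (v : group_algebra R G * group_algebra R G) : l1 := incl (ga_mul v.1 v.2).
have dincl := @incl_dense R G L rho rho0.
have d2 := dense_range_pair dincl dincl.
have hl1 := @l1_hausdorff R G L rho rho0.
have fC (x : l1 * l1) (U : set l1) : nbhs (0 : l1) U ->
  exists2 W : set (l1 * l1), nbhs x W & forall v w,
    W (incl v.1, incl v.2) -> W (incl w.1, incl w.2) -> U (f v - f w).
  case: x => x1 x2 /(nbhs_l1P rho0)[e [t [t0 tU]]].
  have [e' [C [C0 CE]]] := ga_mul_bound LM e.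
  have fin y : pnorm e' y = (fine (pnorm e' y))%:E by rewrite fineK// ell1_minus_norm_fin.
  have ge0 y : 0 <= fine (pnorm e' y) by rewrite -lee_fin -fin ell1_norm_ge0.
  set X := fine (pnorm e' x1); set Y := fine (pnorm e' x2).
  have X0 : 0 <= X := ge0 x1; have Y0 : 0 <= Y := ge0 x2.
  have D0 : 0 < 4 * C * (X + Y + 2) by rewrite !mulr_gt0//; lra.
  (* Within [d] of [(x1, x2)] the factors vary by at most [2 d] and, since [d <= 1], have norms at
     most [X + 1] and [Y + 1]. The product then varies by at most [2 C d (X + Y + 2) <= t / 2]. *)
  pose d := Num.min 1 (t / (4 * C * (X + Y + 2))).
  have d0 : 0 < d by rewrite lt_min ltr01 divr_gt0.
  have d1 : d <= 1 by rewrite ge_min lexx.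
  have dt : d * (4 * C * (X + Y + 2)) <= t.
    by rewrite -ler_pdivlMr// ge_min lexx orbT.
  pose bl (z : l1) : set l1 := [set w | (pnorm e' (w - z)%R < d%:E)%E].
  have nbl z : nbhs z (bl z) by apply/(nbhs_l1P rho0); exists e', d.
  exists (bl x1 `*` bl x2); first by exists (bl x1, bl x2).
  move=> [a b] [a' b'] [/= /ltW ha /ltW hb] [/= /ltW ha' /ltW hb'].
  have haa : (pnorm e' (incl a - incl a')%R <= (d + d)%:E)%E.
    by apply: l1_norm_tri ha _; rewrite l1_norm_sym.
  have hbb : (pnorm e' (incl b - incl b')%R <= (d + d)%:E)%E.
    by apply: l1_norm_tri hb _; rewrite l1_norm_sym.
  have bound y c (Z : R) : (pnorm e' y <= Z%:E)%E -> (pnorm e' (incl c - y)%R <= d%:E)%E ->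
      (pnorm e' (incl c) <= (Z + 1)%:E)%E.
    move=> hy hc; rewrite -(subrK y (incl c)) addrC EFinD.
    apply: le_trans (ell1_minus_normD _ _ _) (leeD hy _).
    by apply: le_trans hc _; rewrite lee_fin.
  have hY : (pnorm e' x2 <= Y%:E)%E by rewrite fin.
  have hX : (pnorm e' x1 <= X%:E)%E by rewrite fin.
  have hb1 := bound _ b _ hY hb; have ha1 := bound _ a' _ hX ha'.
  apply: tU; rewrite subr0 /f /= inclB ga_mulBB.
  apply: le_lt_trans (ell1_normD _ _ _ _ _) _.
  have h1 := CE (a - a') b _ _ haa hb1; have h2 := CE a' (b - b') _ _ ha1 hbb.
  apply: le_lt_trans (leeD h1 h2) _.
  rewrite -EFinD lte_fin [ltLHS](_ : _ = d * (4 * C * (X + Y + 2)) / 2); last by field.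
  lra.
have [Mul cMul MulE] := dense_extension d2 (@l1_complete R G L rho rho0) fC hl1.
exists (fun x y => Mul (x, y)); split; last by move=> a b; rewrite (MulE (a, b)).
have morph : {morph incl : a b / ga_mul a b >-> Mul (a, b)} by move=> a b; rewrite (MulE (a, b)).
apply: (@dense_algebra_law _ _ (@ga_mul R G) l1 (fun x y => Mul (x, y)) incl) => //.
- exact: incl_linear.
- by apply: (continuous_pair_comp cMul); [exact: continuous_fst|exact: continuous_snd].
- exact: ga_mulA.
- exact: ga_mul_linearl.
- exact: ga_mul_linearr.
Qed.

End L1Algebra.

(** * Equality of the two topologies and of the completions *)

Theorem proposition5p2 (R : realType) (G : groupType) (S : set G)
    (hS : finite_symmetric_generating_set S) (rho : R) (hrho : 0 < rho) :
  let L := word_length S in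
  let sigma := fun n : nat => (n`!)%:R : R in
  let CG_bw : preTopologicalLmodType R[i] := seminormed (@bw_seminorm R G L rho) in
  let CG_l1 : preTopologicalLmodType R[i] := seminormed (@ga_ell1_norm R G L sigma rho) in
  let l1 : tvsType R[i] := ell1_minus L sigma rho in
  let incl := @ga_ell1_minus R G L sigma rho in
  (forall U : set (group_algebra R G),
     @open CG_bw U <-> @open CG_l1 U) /\
  (exists mul : l1 -> l1 -> l1,
     algebra_completion (V := CG_bw) (A := l1) (@ga_mul R G) mul incl /\
     (forall (A : tvsType R[i]) (mulA : A -> A -> A) (iota : CG_bw -> A),
        algebra_completion (V := CG_bw) (@ga_mul R G) mulA iota ->
        exists Phi : A -> l1,
          topological_algebra_iso mulA mul Phi /\
          forall a : group_algebra R G, Phi (iota a) = incl a)).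
Proof.
move=> L sigma CG_bw CG_l1 l1 incl.
have L1 := word_length1 hS; have LV := word_lengthV hS; have LM := word_lengthM hS.
have Lsum := word_length_summable hS R.
have topE (U : set (group_algebra R G)) : @open CG_bw U <-> @open CG_l1 U.
  split; apply: gauge_open_dominated => i.
    exact: bw_seminorm_le_ell1.
  exact: ell1_le_bw_seminorm.
split=> //.
have [mul [law morph]] := @l1_mul_exists R G L rho hrho LM.
have compl : algebra_completion (V := CG_bw) (A := l1) (@ga_mul R G) mul incl.
  split => //.
  - exact: l1_hausdorff.
  - exact: l1_complete.
  - exact: incl_linear.
  (* The embedding is known for the weighted norms; [topE] transfers it to the Beiser-Waldmann
     topology. *)
  - by move=> U; rewrite topE; exact: incl_embedding.
  - exact: incl_dense.
exists mul; split=> // A mulA iota cA.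
exact: completion_unique cA compl.
Qed.
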